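(* Let $(M^2,g)$ be a connected, oriented pseudo-Riemannian (possibly Riemannian) 2-manifold with Levi-Civita connection $\nabla$ and natural volume form $\Omega$; let $\omega=1$ if $g$ has signature $(++)$ or $(--)$ and $\omega=-1$ if $g$ has signature $(+-)$. Let $\alpha\colon I\to M^2$ be a smooth curve parametrized by arclength, i.e. $|g(\alpha',\alpha')|=1$ on $I$, such that $\Omega(\alpha',\nabla_{\alpha'}\alpha')\ne0$ everywhere on $I$. Then the equi-affine curvature $\kappa_a$ and the Frenet curvature $\kappa_r$ of $\alpha$ are related by $$\kappa_a=\frac{1}{9\,\kappa_r^{8/3}}\Big(3\kappa_r\kappa_r''-5(\kappa_r')^2+9\omega\kappa_r^4\Big)=-\frac12\Big(\frac{1}{\kappa_r^{2/3}}\Big)''+\omega\,\kappa_r^{4/3}.$$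
   Context: The natural volume form $\Omega$ of $(M^2,g)$ is the 2-form compatible with the orientation given in positively oriented local coordinates $(x^1,x^2)$ by $\Omega=\sqrt{|G|}\,(dx^1\otimes dx^2-dx^2\otimes dx^1)$, where $G=g_{11}g_{22}-g_{12}^2$ (so $\Omega(u,v)=\pm1$ for orthonormal $u,v$, positive when $(u,v)$ is positively oriented). It is parallel with respect to $\nabla$. For a smooth curve $\alpha\colon I\to M^2$ ($I$ an open interval), $\nabla_{\alpha'}$ is covariant differentiation along $\alpha$ with respect to the parameter of $\alpha$, and $\nabla^2_{\alpha'}\alpha'=\nabla_{\alpha'}(\nabla_{\alpha'}\alpha')$. Primes on functions on $I$ denote derivatives in that parameter. Powers with exponents in $\frac13\mathbb Z$ are taken via the real cube root: $x^{m/3}=(\sqrt[3]{x})^m$, for $x$ possibly negative. Frenet curvature: define the $(1,1)$-tensor field $J$ by $g(X,JY)=\Omega(X,Y)$. If $g(\alpha',\alpha')\ne0$ everywhere, put $\nu=|g(\alpha',\alpha')|^{1/2}$, $\mathbf T=\alpha'/\nu$, $\varepsilon=g(\mathbf T,\mathbf T)\in\{1,-1\}$, $\mathbf N=-\omega\varepsilon J\mathbf T$ (the unique unit vector field along $\alpha$ orthogonal to $\mathbf T$ with $(\mathbf T,\mathbf N)$ positively oriented), and $\nabla_{\mathbf T}=\nu^{-1}\nabla_{\alpha'}$. The Frenet curvature $\kappa_r\colon I\to\mathbb R$ is the unique function with $\nabla_{\mathbf T}\mathbf T=\kappa_r\mathbf N$. (For an arclength parametrization $\nu=1$.) Equi-affine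 curvature: if $\Omega(\alpha',\nabla_{\alpha'}\alpha')\ne0$ everywhere, put $\mu=\sqrt[3]{\Omega(\alpha',\nabla_{\alpha'}\alpha')}$ and, for some $t_0\in I$, $\sigma(t)=\int_{t_0}^t\mu(u)\,du$. Then $\sigma'=\mu\neq0$, so $\sigma\colon I\to\sigma(I)$ is a diffeomorphism onto an open interval; let $\overline\alpha\colon\sigma(I)\to M^2$ be the reparametrization with $\alpha=\overline\alpha\circ\sigma$. It satisfies $\Omega(\overline\alpha',\nabla_{\overline\alpha'}\overline\alpha')=1$, hence $\Omega(\overline\alpha',\nabla^2_{\overline\alpha'}\overline\alpha')=0$, so there is a unique function $\overline\kappa_a$ on $\sigma(I)$ with $\nabla^2_{\overline\alpha'}\overline\alpha'=-\overline\kappa_a\,\overline\alpha'$. The equi-affine curvature of $\alpha$ is $\kappa_a=\overline\kappa_a\circ\sigma\colon I\to\mathbb R$ (independent of $t_0$). *)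

(* Defs.v *)
From mathcomp Require Import all_boot all_order all_algebra.
From mathcomp Require Import all_classical all_reals all_analysis.
Set Implicit Arguments.
Unset Strict Implicit.
Unset Printing Implicit Defensive.
Import Order.TTheory GRing.Theory Num.Theory.
Import numFieldNormedType.Exports.
Local Open Scope classical_set_scope.
Local Open Scope ring_scope.

(* Meant for an open U in a finite-dimensional V: f is then C^k on U iff it is
   differentiable on U and each directional derivative is C^(k-1) on U. *)
Fixpoint Ck_on (R : realType) (V W : normedModType R) (k : nat) (U : set V)
    (f : V -> W) : Prop :=
  if k is k'.+1 then
    (forall x, U x -> differentiable f x) /\ (forall v, Ck_on k' U ('D_v f))
  else forall x, U x -> {for x, continuous f}.

Definition smooth_on (R : realType) (V W : normedModType R) (U : set V)
    (f : V -> W) : Prop := forall k, Ck_on k U f.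

(* An oriented smooth surface structure on the space M, given by an oriented
   atlas: chart i is a homeomorphism from the open set dom i onto an open subset
   of R^2 with inverse chartV i; values outside these sets are irrelevant.
   Jacobian matrices act on row vectors from the right, as in [jacobian]. *)
Record oriented_surface (R : realType) (M : topologicalType) := OrientedSurface {
  idx : Type;
  dom : idx -> set M;
  chart : idx -> M -> 'rV[R]_2;
  chartV : idx -> 'rV[R]_2 -> M;
  surf_hausdorff : hausdorff_space M;
  surf_second_countable : @second_countable M;
  dom_open : forall i, open (dom i);
  dom_cover : forall p, exists i, dom i p;
  codom_open : forall i, open (chart i @` dom i);
  chart_continuous : forall i p, dom i p -> {for p, continuous (chart i)};
  chartV_continuous : forall i x, (chart i @` dom i) x ->
    {for x, continuous (chartV i)};
  chartK : forall i p, dom i p -> chartV i (chart i p) = p;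
  transition_smooth : forall i j,
    smooth_on (chart i @` (dom i `&` dom j)) (chart j \o chartV i);
  transition_oriented : forall i j p, dom i p -> dom j p ->
    0 < \det (jacobian (chart j \o chartV i) (chart i p))
}.

Definition transition (R : realType) (M : topologicalType)
    (S : oriented_surface R M) (i j : idx S) : 'rV[R]_2 -> 'rV[R]_2 :=
  chart j \o chartV i.

Definition jac (R : realType) (M : topologicalType)
    (S : oriented_surface R M) (i j : idx S) (p : M) : 'M[R]_2 :=
  jacobian (transition i j) (chart i p).

Definition chart_at (R : realType) (M : topologicalType)
    (S : oriented_surface R M) (p : M) : idx S := sval (cid (dom_cover S p)).

(* A tangent vector at p is encoded by the family of its components in all
   charts; only the charts around p matter, and the components in charts i, j
   around p are related by u j = u i *m jac i j p. *)
Definition tvec (R : realType) (M : topologicalType)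
    (S : oriented_surface R M) : Type := idx S -> 'rV[R]_2.

Definition tvec_eq (R : realType) (M : topologicalType)
    (S : oriented_surface R M) (p : M) (u v : tvec S) : Prop :=
  forall i, dom i p -> u i = v i.

Definition bil (R : realType) (A : 'M[R]_2) (u v : 'rV[R]_2) : R :=
  (u *m A *m v^T) 0 0.

(* G i x is the Gram matrix of the coordinate frame of the chart i at the point
   with coordinates x. *)
Definition has_signature (R : realType) (M : topologicalType)
    (S : oriented_surface R M) (G : idx S -> 'rV[R]_2 -> 'M[R]_2)
    (e1 e2 : R) : Prop :=
  forall i p, dom i p -> exists u v : 'rV[R]_2,
    [/\ bil (G i (chart i p)) u u = e1, bil (G i (chart i p)) v v = e2
      & bil (G i (chart i p)) u v = 0].

(* The existence of orthonormal frames of constant signature includes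
   nondegeneracy. *)
Record pseudo_riemannian (R : realType) (M : topologicalType)
    (S : oriented_surface R M) := PseudoRiemannian {
  gram : idx S -> 'rV[R]_2 -> 'M[R]_2;
  gram_smooth : forall i, smooth_on (chart i @` dom i) (gram i);
  gram_sym : forall i p, dom i p -> (gram i (chart i p))^T = gram i (chart i p);
  gram_change : forall i j p, dom i p -> dom j p ->
    gram i (chart i p) = jac i j p *m gram j (chart j p) *m (jac i j p)^T;
  gram_signature : exists b1 b2 : bool,
    has_signature gram ((-1) ^+ b1) ((-1) ^+ b2)
}.

(* +1 in signature (++) or (--), -1 in signature (+-). *)
Definition omega (R : realType) (M : topologicalType)
    (S : oriented_surface R M) (g : pseudo_riemannian S) : R :=
  if `[< has_signature (gram g) 1 1 \/ has_signature (gram g) (-1) (-1) >]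
  then 1 else -1.

Definition gprod (R : realType) (M : topologicalType)
    (S : oriented_surface R M) (g : pseudo_riemannian S) (p : M)
    (u v : tvec S) : R :=
  let i := chart_at S p in bil (gram g i (chart i p)) (u i) (v i).

(* Matrix of sqrt|det G| (dx1 (x) dx2 - dx2 (x) dx1). *)
Definition vol_mx (R : realType) (G : 'M[R]_2) : 'M[R]_2 :=
  Num.sqrt `|\det G| *: (delta_mx 0 1 - delta_mx 1 0).

Definition Omega (R : realType) (M : topologicalType)
    (S : oriented_surface R M) (g : pseudo_riemannian S) (p : M)
    (u v : tvec S) : R :=
  let i := chart_at S p in bil (vol_mx (gram g i (chart i p))) (u i) (v i).

Definition J_mx (R : realType) (G : 'M[R]_2) : 'M[R]_2 :=
  (vol_mx G)^T *m invmx G.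

Lemma J_mxP (R : realType) (G : 'M[R]_2) (u v : 'rV[R]_2) :
  G^T = G -> G \in unitmx -> bil G u (v *m J_mx G) = bil (vol_mx G) u v.
Proof.
move=> Gs Gu; rewrite /bil /J_mx !trmx_mul trmxK trmx_inv Gs !mulmxA.
by rewrite mulmxK.
Qed.

Definition J (R : realType) (M : topologicalType)
    (S : oriented_surface R M) (g : pseudo_riemannian S) (p : M)
    (u : tvec S) : tvec S :=
  fun i => u i *m J_mx (gram g i (chart i p)).

(* An affine connection given by its Christoffel symbols:
   christoffel i x k a b = Gamma^k_ab at the point with coordinates x in the
   chart i, so that chr i x u v is the vector Gamma^k_ab u^a v^b.  With f the
   transition map to the chart j, conn_change is the transformation law
   Gamma^e_ab d_e f^c = d_a d_b f^c + Gamma'^c_kl d_a f^k d_b f^l. *)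
Definition chr_vec (R : realType) (C : 'I_2 -> 'M[R]_2) (u v : 'rV[R]_2) :
    'rV[R]_2 :=
  \row_k bil (C k) u v.

Record connection (R : realType) (M : topologicalType)
    (S : oriented_surface R M) := Connection {
  christoffel : idx S -> 'rV[R]_2 -> 'I_2 -> 'M[R]_2;
  conn_smooth : forall i k,
    smooth_on (chart i @` dom i) (fun x => christoffel i x k);
  conn_change : forall i j p (u v : 'rV[R]_2), dom i p -> dom j p ->
    chr_vec (christoffel i (chart i p)) u v *m jac i j p =
    'D_u ('D_v (transition i j)) (chart i p)
    + chr_vec (christoffel j (chart j p)) (u *m jac i j p) (v *m jac i j p)
}.

Definition chr (R : realType) (M : topologicalType)
    (S : oriented_surface R M) (nabla : connection S) (i : idx S)
    (x u v : 'rV[R]_2) : 'rV[R]_2 := chr_vec (christoffel nabla i x) u v.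

(* Torsion-free and metric; in the latter condition u, v are fixed constant
   coordinate fields, so that nabla_w u = chr w u. *)
Definition levi_civita (R : realType) (M : topologicalType)
    (S : oriented_surface R M) (g : pseudo_riemannian S)
    (nabla : connection S) : Prop :=
  forall (i : idx S) (p : M), dom i p ->
  let x := chart i p in
  (forall u v, chr nabla i x u v = chr nabla i x v u) /\
  (forall w u v,
     'D_w (fun y => bil (gram g i y) u v) x =
     bil (gram g i x) (chr nabla i x w u) v
     + bil (gram g i x) u (chr nabla i x w v)).

Definition smooth_curve (R : realType) (M : topologicalType)
    (S : oriented_surface R M) (I : set R) (alpha : R -> M) : Prop :=
  (forall t, I t -> {for t, continuous alpha}) /\
  (forall i : idx S,
     smooth_on (I `&` alpha @^-1` dom i) (chart i \o alpha)).

Definition velocity (R : realType) (M : topologicalType)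
    (S : oriented_surface R M) (alpha : R -> M) (t : R) : tvec S :=
  fun i => derive1 (chart i \o alpha) t.
Arguments velocity {R M} S alpha t _.

(* Covariant derivative, along alpha and with respect to its parameter, of the
   vector field V along alpha. *)
Definition covd (R : realType) (M : topologicalType)
    (S : oriented_surface R M) (nabla : connection S) (alpha : R -> M)
    (V : R -> tvec S) (t : R) : tvec S :=
  fun i => derive1 (fun s => V s i) t
    + chr nabla i (chart i (alpha t)) (velocity S alpha t i) (V t i).

Section FrenetCurvature.
Context (R : realType) (M : topologicalType) (S : oriented_surface R M).
Variables (g : pseudo_riemannian S) (nabla : connection S) (alpha : R -> M).

Definition speed (t : R) : R :=
  Num.sqrt `|gprod g (alpha t) (velocity S alpha t) (velocity S alpha t)|.

Definition frenetT (t : R) : tvec S := (speed t)^-1 *: velocity S alpha t.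

Definition epsilonT (t : R) : R := gprod g (alpha t) (frenetT t) (frenetT t).

Definition frenetN (t : R) : tvec S :=
  - (omega g * epsilonT t) *: J g (alpha t) (frenetT t).

Definition nablaT (V : R -> tvec S) (t : R) : tvec S :=
  (speed t)^-1 *: covd nabla alpha V t.

(* [get A] is the element of A when A is a singleton. *)
Definition frenet_curvature (t : R) : R :=
  get [set k : R | tvec_eq (alpha t) (nablaT frenetT t) (k *: frenetN t)].

End FrenetCurvature.

(* Real cube root. *)
Definition cbrt (R : realType) (x : R) : R := Num.sg x * `|x| `^ (3%:R^-1).

(* Integral from a to b, with its sign changed if b < a. *)
Definition oriented_integral (R : realType) (f : R -> R) (a b : R) : R :=
  if a <= b then Rintegral (@lebesgue_measure R) `[a, b] f
  else - Rintegral (@lebesgue_measure R) `[b, a] f.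

Section EquiAffineCurvature.
Context (R : realType) (M : topologicalType) (S : oriented_surface R M).
Variables (g : pseudo_riemannian S) (nabla : connection S).
Variables (I : set R) (alpha : R -> M) (t0 : R).

Definition accel (beta : R -> M) : R -> tvec S :=
  covd nabla beta (velocity S beta).

Definition Omega_accel (t : R) : R :=
  Omega g (alpha t) (velocity S alpha t) (accel alpha t).

Definition mu_affine (t : R) : R := cbrt (Omega_accel t).

Definition sigma_affine (t : R) : R := oriented_integral mu_affine t0 t.

(* 'pinv_d I f is the inverse of f restricted to I. *)
Definition alpha_bar : R -> M := alpha \o 'pinv_(fun=> t0) I sigma_affine.

Definition kappa_bar (s : R) : R :=
  get [set k : R | tvec_eq (alpha_bar s)
    (covd nabla alpha_bar (accel alpha_bar) s)
    (- k *: velocity S alpha_bar s)].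

Definition equiaffine_curvature (t : R) : R := kappa_bar (sigma_affine t).

End EquiAffineCurvature.

(* Main.v *)
Require Import Defs.
From mathcomp Require Import all_boot all_order all_algebra.
From mathcomp Require Import all_classical all_reals all_analysis.
From mathcomp Require Import ring lra.
Set Implicit Arguments.
Unset Strict Implicit.
Unset Printing Implicit Defensive.
Import Order.TTheory GRing.Theory Num.Theory.
Import numFieldNormedType.Exports.
Local Open Scope classical_set_scope.
Local Open Scope ring_scope.

(** Write T for the velocity, A for its covariant derivative, B for that of A,
    and w = Omega(T, A). The proof expresses both curvatures by w alone.

    Since T has constant scalar square eps, it is orthogonal to A, so A is a
    multiple of the unit normal; the Gram identity w^2 = omega eps g(A, A)
    identifies the coefficient, and the Frenet curvature is w
    ([frenet_curvatureE]). Differentiating g(T, A) = 0 and the Gram identity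
    gives the products of B with T and A, hence
    B = - omega w^2 T + (w'/w) A ([covd_accel]).

    Let m = w^(-1/3) = 1 / sigma'. In the affine parameter the velocity is m T,
    and the covariant derivative along the reparametrized curve is m times the
    one along alpha ([covd_reparam]). Applying it twice to m T and inserting
    the formula for B, the coefficient of A is a multiple of 3 m' + m w'/w,
    which vanishes because m^3 w = 1. What remains is a multiple of the affine
    velocity m T, and the equi-affine curvature is
    omega w^2 m^2 - (m m')' ([covd_accel_bar], [equiaffine_curvatureE]).
    As (m m')' is half the second derivative of m^2 = w^(-2/3), this is the
    second expression of the theorem; expanding (m m')' by means of
    3 m' w = - m w' gives the first ([derive_inv_cbrt_sqr]).

    The computations take place in a fixed chart, so it must be known that the
    components of T and A transform as tangent vectors; for A the second
    derivatives of the transition maps are cancelled by the transformation law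
    of the Christoffel symbols ([tensorial_covd]). Then metric product and
    area, defined pointwise in a chart that may change from point to point, can
    be computed around each parameter in one chart ([gprod_chart],
    [Omega_chart]), where they are smooth functions of the parameter. *)

(** * Smooth functions of one real variable *)

Lemma open_cap_preimage (X Y : topologicalType) (A : set X) (B : set Y)
    (f : X -> Y) : open A -> (forall x, A x -> {for x, continuous f}) ->
  open B -> open (A `&` f @^-1` B).
Proof.
move=> oA fc oB; rewrite openE => x [Ax Bfx].
apply: filterI; first exact: open_nbhs_nbhs.
by apply: fc => //; exact: open_nbhs_nbhs.
Qed.

Section KDiff.
Context {R : realType}.
Implicit Types (D : set R) (f g : R -> R) (k : nat).

Fixpoint kdiff k D f : Prop :=
  if k is k'.+1 then
    (forall t, D t -> derivable f t 1) /\ kdiff k' D (derive1 f)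
  else True.

Definition smooth1 D f := forall k, kdiff k D f.

Lemma near_eq_derive1 f g D t : open D -> D t -> {in D, f =1 g} ->
  \near t, f t = g t.
Proof.
move=> oD Dt fg; have := open_nbhs_nbhs (conj oD Dt).
by apply: filterS => s Ds; apply: fg; exact: mem_set.
Qed.

Lemma kdiff_ext k D f g : open D -> {in D, f =1 g} -> kdiff k D f ->
  kdiff k D g.
Proof.
move=> oD; elim: k f g => //= k IH f g fg [df dk]; split=> [t Dt|].
  by apply: near_eq_derivable (df _ Dt); exact: near_eq_derive1 fg.
apply: IH dk => t /set_mem Dt; rewrite !derive1E.
by apply: near_eq_derive; exact: near_eq_derive1 fg.
Qed.

Lemma kdiffS k D f : kdiff k.+1 D f -> kdiff k D f.
Proof. by elim: k f => //= k IH f [df [ddf dk]]; split=> //; apply: IH. Qed.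

Lemma kdiff_cst k D (a : R) : open D -> kdiff k D (fun=> a).
Proof.
move=> oD; elim: k a => //= k IH a; split=> [t _|]; first exact: derivable_cst.
by apply: (kdiff_ext oD _ (IH 0)) => t _; rewrite derive1_cst.
Qed.

Lemma kdiffD k D f g : open D -> kdiff k D f -> kdiff k D g ->
  kdiff k D (fun t => f t + g t).
Proof.
move=> oD; elim: k f g => //= k IH f g [df fk] [dg gk].
split=> [t Dt|]; first by apply: derivableD; auto.
apply: (kdiff_ext oD _ (IH _ _ fk gk)) => t /set_mem Dt.
by rewrite !derive1E (deriveD (df _ Dt) (dg _ Dt)).
Qed.

Lemma kdiffM k D f g : open D -> kdiff k D f -> kdiff k D g ->
  kdiff k D (fun t => f t * g t).
Proof.
move=> oD; elim: k f g => // k IH f g fk1 gk1.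
have [[df fk] [dg gk]] := (fk1, gk1).
split=> [t Dt|]; first by apply: derivableM; auto.
apply: (kdiff_ext oD _ (kdiffD oD (IH _ _ (kdiffS fk1) gk)
                                  (IH _ _ (kdiffS gk1) fk))).
move=> t /set_mem Dt.
by rewrite !derive1E (deriveM (df _ Dt) (dg _ Dt)).
Qed.

(** The exponent is universally quantified because differentiating lowers it
    by one. *)
Lemma kdiff_powR k D f (a : R) : open D -> {in D, forall t, 0 < f t} ->
  kdiff k D f -> kdiff k D (fun t => f t `^ a).
Proof.
move=> oD f0; elim: k a f f0 => // k IH a f f0 fk1.
have [df fk] := fk1.
have dpow t : D t -> is_derive t 1 (fun s => f s `^ a)
    (a * f t `^ (a - 1) * derive1 f t).
  move=> Dt; rewrite derive1E; 
  apply: (@is_derive1_comp _ (fun x => x `^ a) f).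
    apply/is_derive1_powR/f0; exact: mem_set.
  apply: derivableP; exact: df.
split=> [t Dt|]; first by have [] := dpow t Dt.
have h := kdiffM oD (kdiff_cst k a oD) (IH (a - 1) f f0 (kdiffS fk1)).
apply: (kdiff_ext oD _ (kdiffM oD h fk)) => t /set_mem Dt.
by rewrite !derive1E; have [_ ->] := dpow t Dt; rewrite derive1E.
Qed.

Lemma smooth1_ext D f g : open D -> {in D, f =1 g} -> smooth1 D f ->
  smooth1 D g.
Proof. by move=> oD fg sf k; exact: kdiff_ext fg (sf k). Qed.

Lemma smooth1_cst D (a : R) : open D -> smooth1 D (fun=> a).
Proof. by move=> oD k; exact: kdiff_cst. Qed.

Lemma smooth1D D f g : open D -> smooth1 D f -> smooth1 D g ->
  smooth1 D (fun t => f t + g t).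
Proof. by move=> oD sf sg k; exact: kdiffD. Qed.

Lemma smooth1M D f g : open D -> smooth1 D f -> smooth1 D g ->
  smooth1 D (fun t => f t * g t).
Proof. by move=> oD sf sg k; exact: kdiffM. Qed.

Lemma smooth1_powR D f (a : R) : open D -> {in D, forall t, 0 < f t} ->
  smooth1 D f -> smooth1 D (fun t => f t `^ a).
Proof. by move=> oD f0 sf k; exact: kdiff_powR. Qed.

Lemma smooth1_is_derive D f t : smooth1 D f -> D t ->
  is_derive t 1 f (derive1 f t).
Proof. by move=> /(_ 1)[df _] Dt; rewrite derive1E; apply: derivableP; exact: df. Qed.

Lemma smooth1_derive1 D f : smooth1 D f -> smooth1 D (derive1 f).
Proof. by move=> sf k; have [_] := sf k.+1. Qed.

Lemma smooth1_continuous D f t : smooth1 D f -> D t -> {for t, continuous f}.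
Proof.
move=> sf Dt; apply/differentiable_continuous/derivable1_diffP.
by have [] := smooth1_is_derive sf Dt.
Qed.

End KDiff.

(** * Curves in coordinates *)

Section Coordinates.
Context {R : realType}.

Lemma sum2 (V : nmodType) (F : 'I_2 -> V) : \sum_(i < 2) F i = F 0 + F 1.
Proof.
by rewrite big_ord_recl big_ord1; congr (_ + F _); exact: val_inj.
Qed.

Lemma lincomb2_entry m n (A B : 'M[R]_(m, n)) x y i j :
  (x *: A + y *: B) i j = x * A i j + y * B i j.
Proof. by rewrite !mxE. Qed.

Lemma derive1_entry m n (V : R -> 'M[R]_(m, n)) t i j :
  (forall a b, derivable (fun s => V s a b) t 1) ->
  derive1 V t i j = derive1 (fun s => V s i j) t.
Proof.
move=> dV; rewrite !derive1E derive_mx ?mxE//.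
exact/derivable_mxP.
Qed.

Lemma derivable_entry m n (V : R -> 'M[R]_(m, n)) t i j :
  derivable V t 1 -> derivable (fun s => V s i j) t 1.
Proof. by move/derivable_mxP. Qed.

Lemma derive_delta m n (F : 'rV[R]_2 -> 'M[R]_(m, n)) x v :
  differentiable F x ->
  'D_v F x = \sum_(k < 2) v 0 k *: 'D_(delta_mx 0 k) F x.
Proof.
move=> dF; rewrite deriveE// [in LHS](row_sum_delta v) linear_sum.
by apply: eq_bigr => k _; rewrite linearZ deriveE.
Qed.

Lemma is_derive_comp_curve m n (F : 'rV[R]_2 -> 'M[R]_(m, n))
    (c : R -> 'rV[R]_2) t i j :
  differentiable F (c t) -> (forall k, derivable (fun s => c s 0 k) t 1) ->
  is_derive t 1 (fun s => F (c s) i j) ('D_(derive1 c t) F (c t) i j).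
Proof.
move=> dF dc.
have dct : derivable c t 1 by apply/derivable_mxP => a b; rewrite ord1.
have dFc : differentiable (F \o c) t.
  by apply: differentiable_comp => //; exact/derivable1_diffP.
have dFc1 : derivable (F \o c) t 1 by exact/derivable1_diffP.
split; first exact: (derivable_mxP _ _ _).1 dFc1 i j.
transitivity ('D_1 (F \o c) t i j); first by rewrite (derive_mx dFc1) mxE.
congr (fun_of_matrix _ i j).
rewrite deriveE// diff_comp//; last exact/derivable1_diffP.
by rewrite /= -derive1E'; [rewrite deriveE|exact/derivable1_diffP].
Qed.

(** Along the curve, the derivative is the sum of the c_a' times the partial
    derivatives of F, which are again of class C^k; hence an induction on k
    for all F at once. *)
Lemma kdiff_comp k m n (U : set 'rV[R]_2) (D : set R)
    (F : 'rV[R]_2 -> 'M[R]_(m, n)) (c : R -> 'rV[R]_2) i j :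
  open D -> (forall t, D t -> U (c t)) -> Ck_on k U F ->
  (forall a, kdiff k D (fun t => c t 0 a)) ->
  kdiff k D (fun t => F (c t) i j).
Proof.
move=> oD cU; elim: k F => // k IH F [dF FS] ck.
have dc t : D t -> forall a, derivable (fun s => c s 0 a) t 1.
  by move=> Dt a; have [+ _] := ck a; exact.
have dFc t : D t ->
    is_derive t 1 (fun s => F (c s) i j) ('D_(derive1 c t) F (c t) i j).
  by move=> Dt; apply: is_derive_comp_curve; [apply: dF; exact: cU|exact: dc].
split=> [t Dt|]; first by have [] := dFc t Dt.
have h a : kdiff k D (fun t =>
    derive1 (fun s => c s 0 a) t * 'D_(delta_mx 0 a) F (c t) i j).
  apply: kdiffM => //; first by have [] := ck a.
  apply: (IH ('D_(delta_mx 0 a) F)); [exact: FS|move=> b]; apply: kdiffS; exact: ck.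
apply: (kdiff_ext oD _ (kdiffD oD (h 0) (h 1))) => t /set_mem Dt.
rewrite [RHS]derive1E; have [_ ->] := dFc t Dt.
rewrite (derive_delta (derive1 c t)); last by apply: dF; exact: cU.
have c1 a : derive1 c t 0 a = derive1 (fun s => c s 0 a) t.
  by rewrite derive1_entry// => b d; rewrite ord1; exact: dc.
by rewrite sum2 -!c1 lincomb2_entry.
Qed.

Lemma smooth1_comp m n (U : set 'rV[R]_2) (D : set R)
    (F : 'rV[R]_2 -> 'M[R]_(m, n)) (c : R -> 'rV[R]_2) i j :
  open D -> (forall t, D t -> U (c t)) -> smooth_on U F ->
  (forall a, smooth1 D (fun t => c t 0 a)) ->
  smooth1 D (fun t => F (c t) i j).
Proof.
move=> oD cU sF sc k.
by apply: (@kdiff_comp k m n U D F) => // a; exact: sc.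
Qed.

Lemma smooth1_entry m n (D : set R) (c : R -> 'M[R]_(m, n)) i j :
  open D -> smooth_on D c -> smooth1 D (fun t => c t i j).
Proof.
move=> oD sc k; have := sc k; elim: k c {sc} => //= k IH c [dc cS].
have dc1 t : D t -> derivable c t 1 by move=> /dc/derivable1_diffP.
split=> [t Dt|]; first exact/derivable_entry/dc1.
apply: (kdiff_ext oD _ (IH _ (cS 1))) => t /set_mem Dt.
by rewrite derive1E (derive_mx (dc1 _ Dt)) mxE.
Qed.

End Coordinates.

(** * Covariant differentiation along a curve in a chart *)

Section Bil.
Context {R : realType}.
Implicit Types (A B : 'M[R]_2) (u v w : 'rV[R]_2).

Lemma bilE A u v : bil A u v =
  u 0 0 * A 0 0 * v 0 0 + u 0 0 * A 0 1 * v 0 1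
  + u 0 1 * A 1 0 * v 0 0 + u 0 1 * A 1 1 * v 0 1.
Proof. by rewrite /bil mxE sum2 !mxE !sum2; ring. Qed.

Lemma bilDl A u v w : bil A (u + v) w = bil A u w + bil A v w.
Proof. by rewrite !bilE !mxE; ring. Qed.

Lemma bilDr A u v w : bil A w (u + v) = bil A w u + bil A w v.
Proof. by rewrite !bilE !mxE; ring. Qed.

Lemma bilZl A x u v : bil A (x *: u) v = x * bil A u v.
Proof. by rewrite !bilE !mxE; ring. Qed.

Lemma bilZr A x u v : bil A u (x *: v) = x * bil A u v.
Proof. by rewrite !bilE !mxE; ring. Qed.

Lemma bilC A u v : A^T = A -> bil A u v = bil A v u.
Proof.
move=> As; have A01 : A 0 1 = A 1 0 by rewrite -[in LHS]As mxE.
by rewrite !bilE A01; ring.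
Qed.

Lemma is_derive_addf (V : normedModType R) (f f' : V -> R) x h df df' :
  is_derive x h f df -> is_derive x h f' df' ->
  is_derive x h (fun y => f y + f' y) (df + df').
Proof. by move=> F G; exact: (is_deriveD F G). Qed.

Lemma is_derive_mulf (V : normedModType R) (f f' : V -> R) x h df df' :
  is_derive x h f df -> is_derive x h f' df' ->
  is_derive x h (fun y => f y * f' y) (df * f' x + f x * df').
Proof.
move=> F G; have FG : is_derive x h (fun y => f y * f' y) _ := is_deriveM F G.
by apply: (is_derive_eq FG); rewrite /GRing.scale /=; ring.
Qed.

Lemma is_derive_bil (V : normedModType R) (x h : V) (A : V -> 'M[R]_2)
    (u v : V -> 'rV[R]_2) A' u' v' :
  (forall i j, is_derive x h (fun y => A y i j) (A' i j)) ->
  (forall i, is_derive x h (fun y => u y 0 i) (u' 0 i)) ->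
  (forall i, is_derive x h (fun y => v y 0 i) (v' 0 i)) ->
  is_derive x h (fun y => bil (A y) (u y) (v y))
    (bil A' (u x) (v x) + bil (A x) u' (v x) + bil (A x) (u x) v').
Proof.
move=> dA du dv.
have dm i j : is_derive x h (fun y => u y 0 i * A y i j * v y 0 j)
    (u' 0 i * A x i j * v x 0 j + u x 0 i * A' i j * v x 0 j
     + u x 0 i * A x i j * v' 0 j).
  have := dA i j; have := du i; have := dv j => dvj dui dAij.
  by apply: (is_derive_eq (is_derive_mulf (is_derive_mulf dui dAij) dvj)); ring.
have dsum := is_derive_addf (is_derive_addf (is_derive_addf (dm 0 0) (dm 0 1))
  (dm 1 0)) (dm 1 1).
rewrite (_ : (fun y => bil _ _ _) = fun y =>
  u y 0 0 * A y 0 0 * v y 0 0 + u y 0 0 * A y 0 1 * v y 0 1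
  + u y 0 1 * A y 1 0 * v y 0 0 + u y 0 1 * A y 1 1 * v y 0 1); last first.
  by apply/funext => y; rewrite bilE.
by apply: (is_derive_eq dsum); rewrite !bilE; ring.
Qed.

End Bil.

Section Chart.
Context {R : realType} {M : topologicalType} {S : oriented_surface R M}.
Variables (g : pseudo_riemannian S) (nabla : connection S).
Implicit Types (alpha : R -> M) (V W : R -> tvec S) (i j : idx S) (t : R).

Local Notation coord alpha i := (fun s => chart i (alpha s)).

Lemma chart_dom i p : dom i p -> (chart i @` dom i) (chart i p).
Proof. by move=> ip; exists p. Qed.

Lemma differentiable_smooth_on (V W : normedModType R) (U : set V)
  (F : V -> W) x : smooth_on U F -> U x -> differentiable F x.
Proof. by move=> /(_ 1)[dF _] /dF. Qed.

Definition derivable_coords alpha i t :=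
  forall k, derivable (fun s => chart i (alpha s) 0 k) t 1.

Definition derivable_field V i t := forall k, derivable (fun s => V s i 0 k) t 1.

Lemma covd_entry alpha V i t k : derivable_field V i t ->
  covd nabla alpha V t i 0 k = derive1 (fun s => V s i 0 k) t
    + bil (christoffel nabla i (chart i (alpha t)) k)
        (velocity S alpha t i) (V t i).
Proof.
move=> dV; rewrite /covd mxE; congr (_ + _); last by rewrite /chr /chr_vec mxE.
apply: (@derive1_entry R 1 2 (fun s => V s i) t 0 k) => a b.
by rewrite ord1; exact: dV.
Qed.

Lemma chrDr i x u v w : chr nabla i x u (v + w) = chr nabla i x u v + chr nabla i x u w.
Proof. by apply/rowP => k; rewrite !mxE bilDr. Qed.

Lemma chrZl i x a u v : chr nabla i x (a *: u) v = a *: chr nabla i x u v.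
Proof. by apply/rowP => k; rewrite !mxE bilZl. Qed.

Lemma covd_scale alpha (f : R -> R) V i t :
  derivable f t 1 -> derivable_field V i t ->
  covd nabla alpha (fun s => f s *: V s) t i =
  derive1 f t *: V t i + f t *: covd nabla alpha V t i.
Proof.
move=> df dV.
have dfV k : is_derive t 1 (fun s => (f s *: V s) i 0 k)
    (derive1 f t * V t i 0 k + f t * derive1 (fun s => V s i 0 k) t).
  rewrite (_ : (fun s => _) = fun s => f s * V s i 0 k); last first.
    by apply/funext => s; rewrite mxE.
  by rewrite !derive1E; exact: is_derive_mulf (derivableP df) (derivableP (dV k)).
apply/rowP => k; rewrite covd_entry; last first.
  by move=> l; have [] := dfV l.
rewrite derive1E; have [_ ->] := dfV k.
by rewrite bilZr lincomb2_entry covd_entry//; ring.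
Qed.

Lemma covdD alpha V W i t : derivable_field V i t -> derivable_field W i t ->
  covd nabla alpha (fun s => V s + W s) t i =
  covd nabla alpha V t i + covd nabla alpha W t i.
Proof.
move=> dV dW; rewrite /covd chrDr addrACA; congr (_ + _).
have dVm : derivable (fun s => V s i) t 1.
  by apply/derivable_mxP => a b; rewrite ord1; exact: dV.
have dWm : derivable (fun s => W s i) t 1.
  by apply/derivable_mxP => a b; rewrite ord1; exact: dW.
by rewrite !derive1E; exact: (deriveD dVm dWm).
Qed.

(** Metric compatibility is given on constant coordinate fields; it extends
    to fields along a curve because the derivatives of the components are
    exactly what the covariant derivative adds to the Christoffel terms. *)
Lemma is_derive_metric alpha V W i t :
  levi_civita g nabla -> dom i (alpha t) -> derivable_coords alpha i t ->
  derivable_field V i t -> derivable_field W i t ->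
  is_derive t 1 (fun s => bil (gram g i (chart i (alpha s))) (V s i) (W s i))
    (bil (gram g i (chart i (alpha t))) (covd nabla alpha V t i) (W t i)
     + bil (gram g i (chart i (alpha t))) (V t i) (covd nabla alpha W t i)).
Proof.
move=> LC it dc dV dW; set x := chart i (alpha t).
have dG : differentiable (gram g i) x.
  exact: differentiable_smooth_on (gram_smooth g i) (chart_dom it).
set w := velocity S alpha t i.
have dA a b : is_derive t 1 (fun s => gram g i (chart i (alpha s)) a b)
    ('D_w (gram g i) x a b).
  exact: (@is_derive_comp_curve R 2 2 (gram g i) (coord alpha i) t a b dG dc).
have dE (X : R -> tvec S) : derivable_field X i t -> forall k,
    is_derive t 1 (fun s => X s i 0 k) (derive1 (fun s => X s i) t 0 k).
  move=> dX k; rewrite (@derive1_entry _ _ _ (fun s => X s i)).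
    by rewrite derive1E; exact/derivableP/dX.
  by move=> a b; rewrite ord1; exact: dX.
apply: (is_derive_eq (is_derive_bil dA (dE _ dV) (dE _ dW))).
have [_ LCm] := LC i _ it.
have dGw a b : is_derive x w (fun y => gram g i y a b) ('D_w (gram g i) x a b).
  have dGx : derivable (gram g i) x w by exact: diff_derivable.
  apply: DeriveDef; first exact: (derivable_mxP _ _ _).1 dGx a b.
  by rewrite (derive_mx dGx) mxE.
have dcst (u : 'rV[R]_2) k : is_derive x w (fun y : 'rV[R]_2 => u 0 k) ((0 : 'rV[R]_2) 0 k).
  by rewrite mxE; exact: is_derive_cst.
have [_ E] := is_derive_bil dGw (dcst (V t i)) (dcst (W t i)).
move: (LCm w (V t i) (W t i)); rewrite -/x E => LCe.
rewrite /covd -/x -/w !bilDl !bilDr.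
have b0l v : bil (gram g i x) 0 v = 0 by rewrite bilE !mxE; ring.
have b0r v : bil (gram g i x) v 0 = 0 by rewrite bilE !mxE; ring.
by move: LCe; rewrite b0l b0r !addr0 => ->; ring.
Qed.

End Chart.

(** * Tensor fields along a curve do not depend on the chart *)

Section VolumeMatrix.
Context {R : realType}.
Implicit Types (A P : 'M[R]_2) (u v : 'rV[R]_2).

Lemma det2 A : \det A = A 0 0 * A 1 1 - A 0 1 * A 1 0.
Proof.
rewrite (expand_det_row _ 0) sum2 /cofactor !det_mx11 !mxE /=.
rewrite (_ : lift 0 0 = 1); last exact: val_inj.
rewrite (_ : lift 1 0 = 0); last exact: val_inj.
by rewrite expr0 expr1; ring.
Qed.

Lemma bil_congr A P u v : bil (P *m A *m P^T) u v = bil A (u *m P) (v *m P).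
Proof. by rewrite /bil trmx_mul !mulmxA. Qed.

Lemma bil_vol A u v :
  bil (vol_mx A) u v = Num.sqrt `|\det A| * (u 0 0 * v 0 1 - u 0 1 * v 0 0).
Proof. by rewrite bilE /vol_mx !mxE /=; ring. Qed.

(** The sign of the determinant of the change of frame is what makes the
    volume form well defined only on an oriented surface. *)
Lemma bil_vol_congr A P u v : 0 < \det P ->
  bil (vol_mx (P *m A *m P^T)) u v = bil (vol_mx A) (u *m P) (v *m P).
Proof.
move=> P0; rewrite !bil_vol !det_mulmx det_tr.
rewrite mulrAC -expr2 normrM (ger0_norm (sqr_ge0 _)) sqrtrM ?sqr_ge0//.
rewrite sqrtr_sqr (gtr0_norm P0) det2 !mxE !sum2.
by ring.
Qed.

End VolumeMatrix.

Section Tensoriality.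
Context {R : realType} {M : topologicalType} {S : oriented_surface R M}.
Variables (g : pseudo_riemannian S) (nabla : connection S).
Variables (I : set R) (alpha : R -> M).
Hypotheses (I_open : open I) (alpha_smooth : smooth_curve S I alpha).
Implicit Types (V W : R -> tvec S) (i j : idx S) (t : R).

Definition chart_times i : set R := I `&` alpha @^-1` dom i.

Lemma open_chart_times i : open (chart_times i).
Proof.
have [ac _] := alpha_smooth.
exact: open_cap_preimage I_open ac (dom_open i).
Qed.

Lemma smooth_coords i k :
  smooth1 (chart_times i) (fun s => chart i (alpha s) 0 k).
Proof.
apply: (@smooth1_entry _ _ _ _ (chart i \o alpha)); first exact: open_chart_times.
by have [_] := alpha_smooth; exact.
Qed.

Definition smooth_field V i :=
  forall k, smooth1 (chart_times i) (fun s => V s i 0 k).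

Lemma smooth_field_derivable V i t :
  smooth_field V i -> chart_times i t -> derivable_field V i t.
Proof. by move=> sV it k; have [] := smooth1_is_derive (sV k) it. Qed.

Lemma coords_derivable i t : chart_times i t -> derivable_coords alpha i t.
Proof. by move=> it k; have [] := smooth1_is_derive (smooth_coords i k) it. Qed.

Lemma chart_times_codom i t :
  chart_times i t -> (chart i @` dom i) (chart i (alpha t)).
Proof. by move=> [_ it]; exact: chart_dom. Qed.

Lemma smooth_gram i a b :
  smooth1 (chart_times i) (fun s => gram g i (chart i (alpha s)) a b).
Proof.
apply: (@smooth1_comp _ _ _ _ _ (gram g i) (fun s => chart i (alpha s))).
- exact: open_chart_times.
- exact: chart_times_codom.
- exact: gram_smooth.
- exact: smooth_coords.
Qed.

Lemma velocity_entry i t k : chart_times i t ->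
  velocity S alpha t i 0 k = derive1 (fun s => chart i (alpha s) 0 k) t.
Proof.
move=> it; rewrite /velocity (@derive1_entry _ _ _ (chart i \o alpha))//.
by move=> a b; rewrite ord1; exact: coords_derivable.
Qed.

Lemma smooth_velocity i : smooth_field (velocity S alpha) i.
Proof.
move=> k; have /smooth1_derive1 := @smooth_coords i k.
apply: smooth1_ext; first exact: open_chart_times.
by move=> t /set_mem it; rewrite velocity_entry.
Qed.

Lemma smooth_bil i (A : R -> 'M[R]_2) (u v : R -> 'rV[R]_2) :
  (forall a b, smooth1 (chart_times i) (fun s => A s a b)) ->
  (forall a, smooth1 (chart_times i) (fun s => u s 0 a)) ->
  (forall a, smooth1 (chart_times i) (fun s => v s 0 a)) ->
  smooth1 (chart_times i) (fun s => bil (A s) (u s) (v s)).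
Proof.
have oD := @open_chart_times i.
move=> sA su sv; rewrite (_ : (fun s => bil _ _ _) = fun s =>
  u s 0 0 * A s 0 0 * v s 0 0 + u s 0 0 * A s 0 1 * v s 0 1
  + u s 0 1 * A s 1 0 * v s 0 0 + u s 0 1 * A s 1 1 * v s 0 1).
  by do !apply: smooth1D => //; do !apply: smooth1M.
by apply/funext => s; rewrite bilE.
Qed.

Lemma smooth_covd V i : smooth_field V i -> smooth_field (covd nabla alpha V) i.
Proof.
move=> sV k; have oD := @open_chart_times i.
have sC : smooth1 (chart_times i) (fun s =>
    bil (christoffel nabla i (chart i (alpha s)) k) (velocity S alpha s i) (V s i)).
  apply: smooth_bil => [a b||]; last exact: sV.
  - apply: (@smooth1_comp _ _ _ _ _ (fun x => christoffel nabla i x k)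
      (fun s => chart i (alpha s)) a b oD (@chart_times_codom i)).
      exact: conn_smooth.
    exact: smooth_coords.
  - exact: smooth_velocity.
apply: smooth1_ext (smooth1D oD (smooth1_derive1 (sV k)) sC) => //.
move=> t /set_mem it; rewrite covd_entry//.
exact: smooth_field_derivable.
Qed.

(** The transformation law of the components of a tangent vector. *)
Definition tensorial V := forall t i j, I t ->
  dom i (alpha t) -> dom j (alpha t) -> V t j = V t i *m jac i j (alpha t).

Lemma chart_times2 i j t : I t -> dom i (alpha t) -> dom j (alpha t) ->
  (chart i @` (dom i `&` dom j)) (chart i (alpha t)).
Proof. by move=> It it jt; exists (alpha t). Qed.

Lemma near_chart_times i t : I t -> dom i (alpha t) ->
  \forall s \near t, chart_times i s.
Proof.
by move=> It it; apply: open_nbhs_nbhs; split; [exact: open_chart_times|].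
Qed.

Lemma near_overlap i j p : dom i p -> dom j p ->
  \forall y \near chart i p, (chart i @` (dom i `&` dom j)) y.
Proof.
move=> ip jp.
have nc : \forall y \near chart i p, (chart i @` dom i) y.
  by apply: open_nbhs_nbhs; split; [exact: codom_open|exact: chart_dom].
have nj : \forall y \near chart i p, dom j (chartV i y).
  apply: (chartV_continuous (chart_dom ip)); rewrite chartK//.
  by apply: open_nbhs_nbhs; split; [exact: dom_open|].
apply: filterS2 nc nj => _ [q iq <-]; rewrite chartK// => jq.
by exists q.
Qed.

Lemma transitionE i j p : dom i p -> transition i j (chart i p) = chart j p.
Proof. by move=> ip; rewrite /transition /= chartK. Qed.

Lemma differentiable_transition i j p : dom i p -> dom j p ->
  differentiable (transition i j) (chart i p).
Proof.
move=> ip jp; apply: differentiable_smooth_on (transition_smooth i j) _.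
by exists p.
Qed.

Lemma mul_jac i j p v : dom i p -> dom j p ->
  v *m jac i j p = 'D_v (transition i j) (chart i p).
Proof.
by move=> ip jp; rewrite deriveEjacobian//; exact: differentiable_transition.
Qed.

Lemma tensorial_velocity : tensorial (velocity S alpha).
Proof.
move=> t i j It it jt; rewrite mul_jac//; apply/rowP => k.
rewrite velocity_entry; last by split.
have [_ <-] := @is_derive_comp_curve _ _ _ (transition i j)
  (fun s => chart i (alpha s)) t 0 k (differentiable_transition it jt)
  (coords_derivable (conj It it)).
rewrite derive1E; apply: near_eq_derive.
have := near_chart_times It it; apply: filterS => s [_ is_].
by rewrite transitionE.
Qed.

(** The second derivatives of the transition map that appear when the
    components of the field are differentiated are exactly those in the
    transformation law of the Christoffel symbols. *)
Lemma tensorial_covd V : (forall i, smooth_field V i) -> tensorial V ->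
  tensorial (covd nabla alpha V).
Proof.
move=> sV tV t i j It it jt.
set p := alpha t; set x := chart i p; set f := transition i j.
set u := velocity S alpha t i.
have Dsm : smooth_on (chart i @` (dom i `&` dom j)) f := transition_smooth i j.
have xU : (chart i @` (dom i `&` dom j)) x by exact: chart_times2.
have dDf v : differentiable ('D_v f) x.
  by have [_ /(_ v) [+ _]] := Dsm 2; exact.
have nij : \forall s \near t, chart_times i s /\ chart_times j s.
  by apply: filterI; exact: near_chart_times.
have dVi a := smooth1_is_derive (sV i a) (conj It it).
have dDa a k : is_derive t 1 (fun s => 'D_(delta_mx 0 a) f (chart i (alpha s)) 0 k)
    ('D_u ('D_(delta_mx 0 a) f) x 0 k).
  exact: (@is_derive_comp_curve _ _ _ ('D_(delta_mx 0 a) f)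
    (fun s => chart i (alpha s)) t 0 k (dDf _) (coords_derivable (conj It it))).
have DVf k : derive1 (fun s => V s j 0 k) t =
    (derive1 (fun s => V s i 0 0) t * 'D_(delta_mx 0 0) f x 0 k
     + V t i 0 0 * 'D_u ('D_(delta_mx 0 0) f) x 0 k)
  + (derive1 (fun s => V s i 0 1) t * 'D_(delta_mx 0 1) f x 0 k
     + V t i 0 1 * 'D_u ('D_(delta_mx 0 1) f) x 0 k).
  have [_ <-] := is_derive_addf (is_derive_mulf (dVi 0) (dDa 0 k))
                               (is_derive_mulf (dVi 1) (dDa 1 k)).
  rewrite derive1E; apply: near_eq_derive; apply: filterS nij.
  move=> s [[Is is_] [_ js]]; rewrite (tV s i j)// mul_jac//.
  rewrite (derive_delta (V s i)); last exact: differentiable_transition.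
  by rewrite sum2 lincomb2_entry.
have Dlin : 'D_u ('D_(V t i) f) x = V t i 0 0 *: 'D_u ('D_(delta_mx 0 0) f) x
    + V t i 0 1 *: 'D_u ('D_(delta_mx 0 1) f) x.
  have dZ a := is_deriveZ (V t i 0 a) (derivableP (@diff_derivable _ _ _ _ _ u (dDf (delta_mx 0 a)))).
  have [_ <-] := is_deriveD (dZ 0) (dZ 1).
  apply: near_eq_derive; have := near_overlap it jt; apply: filterS => y Uy.
  rewrite derive_delta; last exact: differentiable_smooth_on Dsm Uy.
  by rewrite sum2.
apply/rowP => k.
rewrite covd_entry; last exact: smooth_field_derivable.
rewrite DVf /covd mulmxDl (conn_change nabla (velocity S alpha t i) (V t i) it jt).
rewrite -tensorial_velocity// -tV// -/f -/x -/u Dlin.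
have addE (A B : 'rV[R]_2) : (A + B) 0 k = A 0 k + B 0 k by rewrite mxE.
have chrE (C : 'I_2 -> 'M[R]_2) v w : chr_vec C v w 0 k = bil (C k) v w.
  by rewrite mxE.
have dVt a b : derivable (fun s => V s i a b) t 1.
  by rewrite ord1; have [] := dVi b.
rewrite addE addE chrE lincomb2_entry mul_jac// (derive_delta (derive1 _ t)).
  rewrite sum2 lincomb2_entry !(derive1_entry _ _ dVt) -/f -/x.
  by rewrite [in LHS]addrACA !addrA.
exact: differentiable_transition.
Qed.

Lemma bil_gram_change i j p u v : dom i p -> dom j p ->
  bil (gram g i (chart i p)) u v =
  bil (gram g j (chart j p)) (u *m jac i j p) (v *m jac i j p).
Proof. by move=> ip jp; rewrite (gram_change g ip jp) bil_congr. Qed.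

Lemma bil_vol_change i j p u v : dom i p -> dom j p ->
  bil (vol_mx (gram g i (chart i p))) u v =
  bil (vol_mx (gram g j (chart j p))) (u *m jac i j p) (v *m jac i j p).
Proof.
move=> ip jp; rewrite (gram_change g ip jp) bil_vol_congr//.
exact: (transition_oriented ip jp).
Qed.

Lemma dom_chart_at p : dom (chart_at S p) p.
Proof. exact: (svalP (cid (dom_cover S p))). Qed.

(** The metric product is computed in the chart chosen at each point, and this
    choice varies arbitrarily with t; for differentiation a single chart must
    be used around t. *)
Lemma gprod_chart V W i t : tensorial V -> tensorial W -> I t ->
  dom i (alpha t) -> gprod g (alpha t) (V t) (W t) =
  bil (gram g i (chart i (alpha t))) (V t i) (W t i).
Proof.
move=> tV tW It it; have ct := dom_chart_at (alpha t).
by rewrite (bil_gram_change _ _ it ct) -tV// -tW.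
Qed.

Lemma Omega_chart V W i t : tensorial V -> tensorial W -> I t ->
  dom i (alpha t) -> Omega g (alpha t) (V t) (W t) =
  bil (vol_mx (gram g i (chart i (alpha t)))) (V t i) (W t i).
Proof.
move=> tV tW It it; have ct := dom_chart_at (alpha t).
by rewrite (bil_vol_change _ _ it ct) -tV// -tW.
Qed.

End Tensoriality.

(** * The Frenet equation *)

Section FrameAlgebra.
Context {R : realType}.
Implicit Types (G : 'M[R]_2) (u v x y : 'rV[R]_2).

Definition wedge u v : R := u 0 0 * v 0 1 - u 0 1 * v 0 0.

Lemma sym01 G : G^T = G -> G 1 0 = G 0 1.
Proof. by move=> Gs; rewrite -[in LHS]Gs mxE. Qed.

Lemma gram_det G u v : G^T = G ->
  bil G u u * bil G v v - bil G u v ^+ 2 = \det G * wedge u v ^+ 2.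
Proof.
by move=> Gs; rewrite !bilE det2 (sym01 Gs) /wedge; ring.
Qed.

(** For z = x - y, Cramer's rule in the frame (u, v) gives z G = 0, and Cramer's
    rule for G then gives z = 0. *)
Lemma bil_frame_inj G u v x y : \det G != 0 -> wedge u v != 0 ->
  bil G x u = bil G y u -> bil G x v = bil G y v -> x = y.
Proof.
move=> G0 w0 xu xv.
suff z0 z : bil G z u = 0 -> bil G z v = 0 -> z = 0.
  apply/eqP; rewrite -subr_eq0; apply/eqP/z0.
  - by rewrite -[- y]scaleN1r bilDl bilZl xu; ring.
  - by rewrite -[- y]scaleN1r bilDl bilZl xv; ring.
move=> zu zv.
pose q b := z 0 0 * G 0 b + z 0 1 * G 1 b.
have q0 : q 0 = 0.
  apply: (mulIf w0); rewrite mul0r.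
  transitivity (bil G z u * v 0 1 - bil G z v * u 0 1).
    by rewrite !bilE /q /wedge; ring.
  by rewrite zu zv; ring.
have q1 : q 1 = 0.
  apply: (mulIf w0); rewrite mul0r.
  transitivity (bil G z v * u 0 0 - bil G z u * v 0 0).
    by rewrite !bilE /q /wedge; ring.
  by rewrite zu zv; ring.
have z00 : z 0 0 = 0.
  apply: (mulIf G0); rewrite mul0r.
  transitivity (q 0 * G 1 1 - q 1 * G 1 0); first by rewrite /q det2; ring.
  by rewrite q0 q1; ring.
have z01 : z 0 1 = 0.
  apply: (mulIf G0); rewrite mul0r.
  transitivity (q 1 * G 0 0 - q 0 * G 0 1); first by rewrite /q det2; ring.
  by rewrite q0 q1; ring.
apply/rowP => k; rewrite mxE.
by have [->|->] : k = 0 \/ k = 1 by case: k => [[|[|//]] ?]; [left|right]; exact: val_inj.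
Qed.

Variables (G : 'M[R]_2) (om eps w : R) (u v : 'rV[R]_2).
Hypotheses (G_sym : G^T = G) (G_nondeg : \det G != 0).
Hypotheses (om2 : om ^+ 2 = 1) (om_det : om * \det G = `|\det G|).
Hypotheses (eps2 : eps ^+ 2 = 1) (uu : bil G u u = eps) (uv : bil G u v = 0).
Hypotheses (wE : bil (vol_mx G) u v = w) (w_neq0 : w != 0).

Lemma wedge_neq0 : wedge u v != 0.
Proof.
by apply: contraNneq w_neq0 => w0; rewrite -wE bil_vol -/(wedge u v) w0 mulr0.
Qed.

(** The Gram identity for the orthogonal pair (u, v). *)
Lemma sqr_area : w ^+ 2 = om * eps * bil G v v.
Proof.
have := gram_det u v G_sym; rewrite uu uv expr0n subr0 => e.
rewrite -wE bil_vol -/(wedge u v) exprMn sqr_sqrtr// -om_det.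
by rewrite -[RHS]mulrA e; ring.
Qed.

(** The unit normal of the frame is orthogonal to u, like v; the coefficient is
    found by pairing with v. *)
Lemma normal_eq : v = w *: (- (om * eps) *: (u *m J_mx G)).
Proof.
have Gu : G \in unitmx by rewrite unitmxE unitfE.
have JE x : bil G (u *m J_mx G) x = bil (vol_mx G) x u.
  by rewrite bilC// J_mxP.
apply: (bil_frame_inj G_nondeg wedge_neq0).
- by rewrite !bilZl JE bil_vol bilC// uv; ring.
- rewrite !bilZl JE.
  have -> : bil (vol_mx G) v u = - w by rewrite -wE !bil_vol; ring.
  transitivity (om * eps * w ^+ 2); last by ring.
  rewrite sqr_area; transitivity (om ^+ 2 * eps ^+ 2 * bil G v v); last by ring.
  by rewrite om2 eps2; ring.
Qed.

(** The coefficients of x are forced by its products with u and v, which are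
    orthogonal: bil G v v = om eps w^2, and eps^2 = om^2 = 1. *)
Lemma second_derivative_eq (w' : R) x :
  bil G u x = - bil G v v -> w * w' = om * eps * bil G v x ->
  x = - (om * w ^+ 2) *: u + (w' / w) *: v.
Proof.
move=> ux vx; have vvE : bil G v v = om * eps * w ^+ 2.
  rewrite sqr_area; transitivity (om ^+ 2 * eps ^+ 2 * bil G v v); last by ring.
  by rewrite om2 eps2; ring.
have vxE : bil G v x = om * eps * (w * w').
  rewrite vx; transitivity (om ^+ 2 * eps ^+ 2 * bil G v x); last by ring.
  by rewrite om2 eps2; ring.
apply: (bil_frame_inj G_nondeg wedge_neq0).
- by rewrite bilC// ux bilDl !bilZl (bilC v u)// uv uu vvE; ring.
- rewrite bilC// vxE bilDl !bilZl uv vvE.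
  by field.
Qed.

End FrameAlgebra.

Section Signature.
Context {R : realType} {M : topologicalType} {S : oriented_surface R M}.
Variable g : pseudo_riemannian S.

Lemma omega_sqr : omega g ^+ 2 = 1.
Proof. by rewrite /omega; case: ifP; rewrite ?expr1n ?sqrrN ?expr1n. Qed.

Lemma signature_det i p e1 e2 : dom i p -> has_signature (gram g) e1 e2 ->
  exists d, e1 * e2 = \det (gram g i (chart i p)) * d ^+ 2.
Proof.
move=> ip /(_ i p ip) [u [v [uu vv uv]]]; exists (wedge u v).
have := gram_det u v (gram_sym g ip).
by rewrite uu vv uv expr0n subr0.
Qed.

(** By the Gram identity in an orthonormal frame, the sign of the determinant is
    the product of the two signs of the signature. At the given point it
    therefore excludes the signatures that would give omega the other value. *)
Lemma omega_det i p : dom i p ->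
  \det (gram g i (chart i p)) != 0 /\
  omega g * \det (gram g i (chart i p)) = `|\det (gram g i (chart i p))|.
Proof.
move=> ip; set D := \det _.
have pos e : e ^+ 2 = 1 -> has_signature (gram g) e e -> 0 < D.
  move=> e2 /(signature_det ip)[d]; rewrite -expr2 e2 -/D => De.
  have [//|D0|D0] := ltgtP 0 D.
    have : D * d ^+ 2 <= 0 by rewrite nmulr_rle0// sqr_ge0.
    by rewrite -De ler10.
  by move: De; rewrite -D0 mul0r => /eqP; rewrite oner_eq0.
have [b1 [b2 sb]] := gram_signature g.
have [eb|nb] := eqVneq b1 b2.
  have D0 : 0 < D by apply: (pos ((-1) ^+ b1)); rewrite ?sqrr_sign//; rewrite -eb in sb.
  split; first by rewrite gt_eqF.
  rewrite gtr0_norm// /omega asboolT ?mul1r//.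
  by move: sb; rewrite -eb; case: (b1) => /=; rewrite ?expr1 ?expr0; [right|left].
have D0 : D < 0.
  have [d] := signature_det ip sb.
  have -> : (-1) ^+ b1 * (-1) ^+ b2 = -1 :> R.
    by move: nb; case: (b1); case: (b2) => //=; rewrite ?expr0 ?expr1 ?mulr1 ?mul1r.
  rewrite -/D => e; have [//|D0|D0] := ltgtP D 0.
    have : 0 <= D * d ^+ 2 by rewrite mulr_ge0 ?sqr_ge0// ltW.
    by rewrite -e oppr_ge0 ler10.
  by move: e; rewrite D0 mul0r => /eqP; rewrite oppr_eq0 oner_eq0.
split; first by rewrite lt_eqF.
rewrite ltr0_norm// /omega asboolF ?mulN1r// => -[] h.
- by have := pos 1 (expr1n _ _) h; rewrite ltNge ltW.
- have : 0 < D by apply: (pos (-1)) => //; rewrite sqrrN expr1n.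
  by rewrite ltNge ltW.
Qed.

End Signature.

(** * Unit speed curves *)

Section LocalSmooth.
Context {R : realType}.

Lemma double_inj (a b : R) : a + a = b + b -> a = b.
Proof. by move=> h; lra. Qed.

Lemma smooth1_local (D : set R) (f : R -> R) :
  (forall t, D t -> exists E, E t /\ smooth1 E f) -> smooth1 D f.
Proof.
move=> + k; elim: k f => // k IH f lf; split=> [t /lf[E [Et sf]]|].
  by have [] := smooth1_is_derive sf Et.
apply: IH => t /lf[E [Et sf]]; exists E; split=> //.
exact: smooth1_derive1.
Qed.

End LocalSmooth.

Section UnitSpeed.
Context {R : realType} {M : topologicalType} {S : oriented_surface R M}.
Variables (g : pseudo_riemannian S) (nabla : connection S).
Variables (I : set R) (alpha : R -> M).
Hypotheses (nabla_LC : levi_civita g nabla) (I_open : open I).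
Hypothesis alpha_smooth : smooth_curve S I alpha.
Hypothesis alpha_arclength : forall t, I t ->
  `|gprod g (alpha t) (velocity S alpha t) (velocity S alpha t)| = 1.
Hypothesis alpha_nondeg : forall t, I t -> Omega_accel g nabla alpha t <> 0.

Let T := velocity S alpha.
Let A := accel nabla alpha.
Let w := Omega_accel g nabla alpha.
Let eps t := gprod g (alpha t) (T t) (T t).
Let G i t := gram g i (chart i (alpha t)).
Let D (i : idx S) := chart_times I alpha i.

Lemma smooth_accel i : smooth_field I alpha A i.
Proof. exact/smooth_covd/smooth_velocity. Qed.

Lemma tensorial_accel : tensorial I alpha A.
Proof.
apply: tensorial_covd => //; last exact: tensorial_velocity.
by move=> i; exact: smooth_velocity.
Qed.

Lemma tensorial_T : tensorial I alpha T.
Proof. exact: (tensorial_velocity I_open alpha_smooth). Qed.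

Lemma speed_product_chart i t : D i t -> eps t = bil (G i t) (T t i) (T t i).
Proof. by move=> [It it]; exact: (gprod_chart g tensorial_T tensorial_T It it). Qed.

Lemma Omega_accel_chart i t : D i t ->
  w t = bil (vol_mx (G i t)) (T t i) (A t i).
Proof.
by move=> [It it]; exact: (Omega_chart g tensorial_T tensorial_accel It it).
Qed.

Lemma det_gramP i t : D i t ->
  \det (G i t) != 0 /\ omega g * \det (G i t) = `|\det (G i t)|.
Proof. by move=> [_ it]; exact: omega_det. Qed.

(** In a chart this is a square root times a polynomial in the components, and
    the radicand |det G| = omega det G is smooth and positive. *)
Lemma smooth_Omega_accel : smooth1 I w.
Proof.
apply: smooth1_local => t It.
pose i := chart_at S (alpha t).
have it : dom i (alpha t) := dom_chart_at (alpha t).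
exists (D i); split; first exact: conj It it.
have oD : open (D i) by exact: open_chart_times.
have sG a b : smooth1 (D i) (fun s => G i s a b) by exact: smooth_gram.
have sw : smooth1 (D i) (fun s => (omega g * \det (G i s)) `^ (2^-1) *
    wedge (T s i) (A s i)).
  have sN f : smooth1 (D i) f -> smooth1 (D i) (fun s => -1 * f s).
    by move=> sf; exact: (smooth1M oD (smooth1_cst _ oD) sf).
  apply: smooth1M => //.
    apply: smooth1_powR => //.
      move=> s /set_mem Ds; have [d0 ->] := det_gramP Ds.
      by rewrite normr_gt0.
    apply: (smooth1M oD (smooth1_cst _ oD)).
    rewrite (_ : (fun s => _) = fun s => G i s 0 0 * G i s 1 1
      + -1 * (G i s 0 1 * G i s 1 0)); last first.
      by apply/funext => s; rewrite det2; ring.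
    apply: smooth1D => //; first exact: (smooth1M oD).
    by apply: sN; exact: (smooth1M oD).
  rewrite (_ : (fun s => _) = fun s => T s i 0 0 * A s i 0 1
    + -1 * (T s i 0 1 * A s i 0 0)); last first.
    by apply/funext => s; rewrite /wedge; ring.
  have sT a : smooth1 (D i) (fun s => T s i 0 a) by exact: smooth_velocity.
  have sA a : smooth1 (D i) (fun s => A s i 0 a) by exact: smooth_accel.
  apply: smooth1D => //; first exact: (smooth1M oD).
  by apply: sN; exact: (smooth1M oD).
apply: smooth1_ext sw => // s /set_mem Ds.
have [d0 de] := det_gramP Ds.
by rewrite de powR12_sqrt// (Omega_accel_chart Ds) bil_vol.
Qed.

Lemma eps_sqr t : I t -> eps t ^+ 2 = 1.
Proof.
move=> It; rewrite -[eps t ^+ 2]ger0_norm ?sqr_ge0// normrX.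
by rewrite alpha_arclength// expr1n.
Qed.

Lemma is_derive_gram_product V W i t : D i t ->
  smooth_field I alpha V i -> smooth_field I alpha W i ->
  is_derive t 1 (fun s => bil (G i s) (V s i) (W s i))
    (bil (G i t) (covd nabla alpha V t i) (W t i)
     + bil (G i t) (V t i) (covd nabla alpha W t i)).
Proof.
move=> it sV sW; apply: is_derive_metric => //; first by have [] := it.
- exact: (coords_derivable I_open alpha_smooth it).
- exact: smooth_field_derivable it.
- exact: smooth_field_derivable it.
Qed.

Lemma near_times i t : D i t -> \forall s \near t, D i s.
Proof. by move=> it; apply: open_nbhs_nbhs; split=> //; exact: open_chart_times. Qed.

(** The function eps has square 1; differentiating this gives 2 eps eps' = 0,
    and eps does not vanish. *)
Lemma is_derive_eps t : I t -> is_derive t 1 eps 0.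
Proof.
move=> It; pose i := chart_at S (alpha t).
have it : dom i (alpha t) := dom_chart_at (alpha t).
have Dt : D i t := conj It it.
have sT := smooth_velocity I_open alpha_smooth i.
have dE := is_derive_gram_product Dt sT sT; set e' := (X in is_derive _ _ _ X) in dE.
have deps : is_derive t 1 eps e'.
  apply: near_eq_is_derive dE; have := near_times Dt; apply: filterS => s Ds.
  by rewrite (speed_product_chart Ds).
have [_ d2] := is_derive_mulf deps deps.
have e0 : e' * eps t + eps t * e' = 0.
  rewrite -d2 (_ : 0 = 'D_1 (fun=> 1 : R) t); last by rewrite derive_cst.
  apply: near_eq_derive; have := near_times Dt; apply: filterS => s [Is _].
  by rewrite -expr2 eps_sqr.
suff <- : e' = 0 by [].
have en0 : eps t != 0.
  by apply/eqP => h; move: (eps_sqr It); rewrite h expr0n => /esym/eqP; rewrite oner_eq0.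
apply: (mulIf en0); rewrite mul0r; apply: double_inj.
by rewrite addr0 -[RHS]e0 [eps t * e']mulrC.
Qed.

(** Since g(T, T) has derivative 2 g(T, A). *)
Lemma velocity_orth_accel i t : D i t -> bil (G i t) (T t i) (A t i) = 0.
Proof.
move=> Dt; have sT := smooth_velocity I_open alpha_smooth i.
have [_ dE] := is_derive_gram_product Dt sT sT.
have [_ de] := is_derive_eps (Dt.1).
have : bil (G i t) (A t i) (T t i) + bil (G i t) (T t i) (A t i) = 0.
  rewrite -dE -de; apply: near_eq_derive.
  have := near_times Dt; apply: filterS => s Ds.
  by rewrite (speed_product_chart Ds).
rewrite bilC; last by apply: gram_sym; exact: Dt.2.
by move=> h; apply: double_inj; rewrite addr0.
Qed.

Lemma Omega_accel_sqr i t : D i t ->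
  w t ^+ 2 = omega g * eps t * bil (G i t) (A t i) (A t i).
Proof.
move=> Dt; have [d0 de] := det_gramP Dt.
exact: (sqr_area (gram_sym g Dt.2) de (esym (speed_product_chart Dt))
  (velocity_orth_accel Dt) (esym (Omega_accel_chart Dt))).
Qed.

(** Differentiating g(T, A) = 0 and w^2 = omega eps g(A, A) gives the products
    g(T, B) = - g(A, A) and omega eps g(A, B) = w w' of the derivative B of the
    acceleration with the orthogonal frame (T, A). *)
Lemma covd_accel i t : D i t ->
  covd nabla alpha A t i =
  - (omega g * w t ^+ 2) *: T t i + (derive1 w t / w t) *: A t i.
Proof.
move=> Dt; have [d0 de] := det_gramP Dt; have [It it] := Dt.
have sT := smooth_velocity I_open alpha_smooth i.
have sA := @smooth_accel i.
have Gs : (G i t)^T = G i t by exact: gram_sym.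
have w0 : w t != 0 by apply/eqP/alpha_nondeg.
apply: (second_derivative_eq Gs d0 (omega_sqr g) de (eps_sqr It)
  (esym (speed_product_chart Dt)) (velocity_orth_accel Dt)
  (esym (Omega_accel_chart Dt)) w0).
- have [_ dE] := is_derive_gram_product Dt sT sA.
  have : bil (G i t) (A t i) (A t i)
      + bil (G i t) (T t i) (covd nabla alpha A t i) = 0.
    rewrite -dE (_ : 0 = 'D_1 (fun=> 0 : R) t); last by rewrite derive_cst.
    apply: near_eq_derive; have := near_times Dt; apply: filterS => s Ds.
    exact: velocity_orth_accel.
  by move/eqP; rewrite addrC addr_eq0 => /eqP.
- have dw := smooth1_is_derive smooth_Omega_accel It.
  have [_ dww] := is_derive_mulf dw dw.
  have [_ daa] := is_derive_mulf
    (is_derive_mulf (is_derive_cst (omega g) t 1) (is_derive_eps It))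
    (is_derive_gram_product Dt sA sA).
  have : derive1 w t * w t + w t * derive1 w t =
      omega g * eps t * (bil (G i t) (A t i) (covd nabla alpha A t i)
        + bil (G i t) (A t i) (covd nabla alpha A t i)).
    rewrite [X in _ * (X + _)]bilC//.
    transitivity ('D_1 (fun s => w s * w s) t) => //.
    transitivity ('D_1 (fun s => omega g * eps s *
      bil (G i s) (A s i) (A s i)) t).
      apply: near_eq_derive; have := near_times Dt; apply: filterS => s Ds.
      by rewrite -expr2 (Omega_accel_sqr Ds).
    by rewrite daa mulr0 mul0r addr0 mul0r add0r.
  by rewrite mulrDr [_ * w t]mulrC => /double_inj.
Qed.

Lemma covd_near V W i t : (\forall s \near t, V s i = W s i) ->
  covd nabla alpha V t i = covd nabla alpha W t i.
Proof.
move=> VW; rewrite /covd (nbhs_singleton VW); congr (_ + _).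
by rewrite !derive1E; exact: near_eq_derive.
Qed.

Lemma frenetT_unit t : I t -> frenetT g alpha t = T t.
Proof.
by move=> It; rewrite /frenetT /speed alpha_arclength// sqrtr1 invr1 scale1r.
Qed.

(** The acceleration is w times the unit normal, by the choice of sign in the
    normal. *)
Lemma frenet_curvatureE t : I t -> frenet_curvature g nabla alpha t = w t.
Proof.
move=> It; rewrite /frenet_curvature.
have nTE i : dom i (alpha t) -> nablaT g nabla alpha (frenetT g alpha) t i = A t i.
  move=> it; rewrite /nablaT /speed alpha_arclength// sqrtr1 invr1 scale1r.
  apply: covd_near; have := near_times (conj It it : D i t).
  by apply: filterS => s [Is _]; rewrite frenetT_unit.
have frenet i : dom i (alpha t) -> A t i = w t *: frenetN g alpha t i.
  move=> it; have Dt : D i t := conj It it.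
  have [d0 de] := det_gramP Dt.
  have epsE : epsilonT g alpha t = eps t by rewrite /epsilonT frenetT_unit.
  have NE : frenetN g alpha t i = - (omega g * eps t) *: (T t i *m J_mx (G i t)).
    by rewrite /frenetN epsE /J frenetT_unit.
  have w0 : w t != 0 by apply/eqP/alpha_nondeg.
  rewrite NE; exact: (normal_eq (gram_sym g it) d0 (omega_sqr g) de (eps_sqr It)
    (esym (speed_product_chart Dt)) (velocity_orth_accel Dt)
    (esym (Omega_accel_chart Dt)) w0).
apply: get_unique => [i it|k /(_ _ (dom_chart_at (alpha t)))].
  by rewrite nTE// frenet.
set i := chart_at S (alpha t).
have it : dom i (alpha t) := dom_chart_at (alpha t).
have Dt : D i t := conj It it.
rewrite nTE// frenet//.
change (w t *: frenetN g alpha t i = k *: frenetN g alpha t i -> k = w t).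
move=> /eqP; rewrite -subr_eq0 -scalerBl scaler_eq0 => /orP[|/eqP N0].
  by rewrite subr_eq0 => /eqP.
have := Omega_accel_chart Dt; rewrite frenet// N0 scaler0 bil_vol !mxE => w0.
by have := alpha_nondeg It; rewrite -/(w t) w0; case; ring.
Qed.

End UnitSpeed.

(** * The affine arclength and its inverse *)

Section OrientedIntegral.
Context {R : realType}.
Variables (I : set R) (f : R -> R).
Hypotheses (I_open : open I) (I_interval : is_interval I).
Hypothesis f_cont : forall t, I t -> {for t, continuous f}.

Let P a x := Rintegral (@lebesgue_measure R) `[a, x] f.

Lemma open_extend t : I t -> exists a b, [/\ I a, I b & a < t < b].
Proof.
move=> It; have /nbhs_ballP[e /= e0 eI] : nbhs t I by exact: open_nbhs_nbhs.
have e2 : 0 < e / 2 by rewrite divr_gt0.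
exists (t - e / 2), (t + e / 2); split.
- apply: eI; rewrite /ball /= opprB addrC subrK gtr0_norm//.
  by rewrite ltr_pdivrMr// mulr_natr mulr2n ltrDl.
- apply: eI; rewrite /ball /= opprD addrA subrr sub0r normrN gtr0_norm//.
  by rewrite ltr_pdivrMr// mulr_natr mulr2n ltrDl.
- by rewrite ltrBlDr !ltrDl e2.
Qed.

Lemma within_segment_continuous a b : I a -> I b -> {within `[a, b], continuous f}.
Proof.
move=> Ia Ib; apply: continuous_in_subspaceT => x /set_mem /=.
by rewrite in_itv /= => axb; apply: f_cont; exact: I_interval axb.
Qed.

Lemma integrable_segment a b : I a -> I b ->
  (@lebesgue_measure R).-integrable `[a, b] (EFin \o f).
Proof.
move=> Ia Ib; apply: continuous_compact_integrable; first exact: segment_compact.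
exact: within_segment_continuous.
Qed.

Lemma primitive_sub a p q : I a -> I q -> a <= p -> p <= q ->
  P a q - P a p = Rintegral (@lebesgue_measure R) `[p, q] f.
Proof.
move=> Ia Iq ap pq; have Ip : I p by apply: (I_interval Ia Iq); rewrite ap.
rewrite /P Rintegral_itvB ?bnd_simp//; last exact: integrable_segment.
rewrite Rintegral_itv_obnd_cbnd//.
apply: integrableS (integrable_segment Ip Iq) => //.
by apply: subset_itvr; rewrite bnd_simp.
Qed.

Lemma oriented_integralE a p q : I a -> I p -> I q -> a <= p -> a <= q ->
  oriented_integral f p q = P a q - P a p.
Proof.
move=> Ia Ip Iq ap aq; rewrite /oriented_integral; case: leP => pq.
  by rewrite -(primitive_sub Ia Iq ap pq).
by rewrite -(primitive_sub Ia Ip aq (ltW pq)) opprB.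
Qed.

(** The lower bound is moved to a point a of I with a <= t0 and a < t, so that
    near t the oriented integral is a primitive minus a constant. *)
Lemma is_derive_oriented_integral t0 t : I t0 -> I t ->
  is_derive t 1 (oriented_integral f t0) (f t).
Proof.
move=> It0 It; have [a1 [b [Ia1 Ib /andP[a1t tb]]]] := open_extend It.
have [a [Ia at0 at_]] : exists a, [/\ I a, a <= t0 & a < t].
  have [h|h] := leP t0 a1; first by exists t0; rewrite (le_lt_trans h).
  by exists a1; rewrite (ltW h).
have [dP PE] := continuous_FTC1_closed tb (integrable_segment Ia Ib) at_ (f_cont It).
have dP1 : is_derive t 1 (P a) (f t).
  by split; [exact: dP|rewrite -derive1E; exact: PE].
have dP2 : is_derive t 1 (fun s => P a s - P a t0) (f t).
  by have := is_deriveB dP1 (is_derive_cst (P a t0) t 1); rewrite subr0.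
apply: near_eq_is_derive dP2.
have nI : \forall s \near t, I s by exact: open_nbhs_nbhs.
have na : \forall s \near t, a < s by exact: lt_nbhsr.
apply: filterS2 nI na => s Is as_.
by rewrite (oriented_integralE Ia)// ltW.
Qed.

Hypothesis f_neq0 : forall t, I t -> f t != 0.

Let F t0 := oriented_integral f t0.

(** By the mean value theorem, two equal values of the integral would force a
    zero of f between them. *)
Lemma oriented_integral_inj t0 : I t0 -> {in I &, injective (F t0)}.
Proof.
move=> It0; suff lt_neq x y : I x -> I y -> x < y -> F t0 x <> F t0 y.
  move=> x y /set_mem Ix /set_mem Iy e; have [xy|xy|//] := ltgtP x y.
  - by have := lt_neq _ _ Ix Iy xy.
  - by have := lt_neq _ _ Iy Ix xy; rewrite e.
move=> Ix Iy xy e.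
have xyI z : z \in `[x, y] -> I z.
  by rewrite in_itv /=; exact: I_interval.
have dF z : I z -> is_derive z 1 (F t0) (f z) by exact: is_derive_oriented_integral.
have cF : {within `[x, y], continuous (F t0)}.
  apply: continuous_in_subspaceT => z /set_mem /= zxy.
  apply/differentiable_continuous/derivable1_diffP.
  by have [] := dF _ (xyI _ zxy).
have dFo z : z \in `]x, y[ -> is_derive z 1 (F t0) (f z).
  by move=> zxy; apply/dF/xyI; exact: subset_itv_oo_cc zxy.
have [c cxy] := MVT xy dFo cF.
rewrite e subrr => /esym/eqP; rewrite mulf_eq0 subr_eq0 (gt_eqF xy) orbF.
by apply/negP/f_neq0/xyI; exact: subset_itv_oo_cc cxy.
Qed.

Lemma oriented_integralK t0 t : I t0 -> I t ->
  'pinv_(fun=> t0) I (F t0) (F t0 t) = t.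
Proof. by move=> It0 It; apply: pinvKV; [exact: oriented_integral_inj|exact: mem_set]. Qed.

Lemma near_inverse t0 t : I t0 -> I t ->
  {near F t0 t, continuous ('pinv_(fun=> t0) I (F t0))} /\
  {near F t0 t, cancel ('pinv_(fun=> t0) I (F t0)) (F t0)}.
Proof.
move=> It0 It; have nI : \forall s \near t, I s by exact: open_nbhs_nbhs.
apply: near_can_continuousAcan_sym; apply: filterS nI => s Is.
  exact: oriented_integralK.
apply/differentiable_continuous/derivable1_diffP.
by have [] := is_derive_oriented_integral It0 Is.
Qed.

Lemma is_derive_inverse_integral t0 t : I t0 -> I t ->
  is_derive (F t0 t) 1 ('pinv_(fun=> t0) I (F t0)) (f t)^-1.
Proof.
move=> It0 It; have nI : \forall s \near t, I s by exact: open_nbhs_nbhs.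
apply: (@is_derive_inverse _ (F t0)).
- by apply: filterS nI => s Is; exact: oriented_integralK.
- apply: filterS nI => s Is; apply/differentiable_continuous/derivable1_diffP.
  by have [] := is_derive_oriented_integral It0 Is.
- exact: is_derive_oriented_integral.
- exact: f_neq0.
Qed.

End OrientedIntegral.

Section CubeRoot.
Context {R : realType}.
Implicit Types x : R.

Lemma cbrt_cube x : cbrt x ^+ 3 = x.
Proof.
rewrite /cbrt exprMn -[_ `^ _ ^+ 3](powR_mulrn 3 (powR_ge0 _ _)) -powRrM.
rewrite mulVf ?pnatr_eq0// powRr1//.
by rewrite exprS sqr_sg; case: sgrP => [->|h|h]; rewrite ?eqxx ?normr0;
  rewrite ?mulr0 ?mulr1 ?mul1r ?mulN1r ?opprK//.
Qed.

Lemma cbrt_neq0 x : x != 0 -> cbrt x != 0.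
Proof.
by apply: contraNneq => x0; rewrite -(cbrt_cube x) x0 expr0n.
Qed.

(** The sign of w is locally constant, and near each point the function is
    that sign times a power of a smooth positive function. *)
Lemma smooth1_signed_powR (I : set R) (w : R -> R) (a : R) : open I ->
  (forall t, I t -> w t != 0) -> smooth1 I w ->
  smooth1 I (fun t => Num.sg (w t) * `|w t| `^ a).
Proof.
move=> oI w0 sw; apply: smooth1_local => t It.
pose e := Num.sg (w t).
have wt : 0 < e * w t by rewrite /e -normrEsg normr_gt0 w0.
pose E := I `&` w @^-1` [set x | 0 < e * x].
have oE : open E.
  apply: open_cap_preimage => //; first by move=> s; exact: smooth1_continuous.
  apply: (@open_comp _ _ (fun x => e * x) [set x | 0 < x]); last exact: open_gt.
  by move=> x _; exact: mulrl_continuous.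
exists E; split; first by split.
have sE : smooth1 E w by apply: smooth1_local => s [Is _]; exists I.
have sEe : smooth1 E (fun s => e * (e * w s) `^ a).
  apply: (smooth1M oE (smooth1_cst _ oE)).
  apply: (smooth1_powR _ oE); first by move=> s /set_mem[].
  exact: (smooth1M oE (smooth1_cst _ oE)).
apply: smooth1_ext sEe => // s /set_mem[Is /= ew].
suff -> : e = Num.sg (w s) by rewrite -normrEsg.
move: wt ew; rewrite /e.
have := w0 _ Is; have := w0 _ It.
by do 2!case: sgrP => //; rewrite ?mul1r ?mulN1r ?oppr_gt0; move=> *; lra.
Qed.

End CubeRoot.

(** * The equi-affine curvature *)

Section Reparametrization.
Context {R : realType} {M : topologicalType} {S : oriented_surface R M}.
Variables (nabla : connection S) (alpha : R -> M) (tau : R -> R).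
Implicit Types (V W : R -> tvec S) (i : idx S) (s d : R).

Lemma derive1_reparam n (X : R -> 'rV[R]_n) s d : is_derive s 1 tau d ->
  (forall k, derivable (fun u => X u 0 k) (tau s) 1) ->
  derive1 (X \o tau) s = d *: derive1 X (tau s).
Proof.
move=> dtau dX.
have dXk k : is_derive s 1 (fun u => X (tau u) 0 k)
    (derive1 (fun u => X u 0 k) (tau s) * d).
  apply: (@is_derive1_comp _ (fun u => X u 0 k) tau).
  by rewrite derive1E; exact: derivableP (dX k).
apply/rowP => k; rewrite derive1_entry; last first.
  by move=> a b; rewrite ord1; have [] := dXk b.
rewrite mxE derive1_entry; last by move=> a b; rewrite ord1; exact: dX.
by rewrite derive1E; have [_ ->] := dXk k; rewrite mulrC.
Qed.

Lemma velocity_reparam i s d : is_derive s 1 tau d ->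
  derivable_coords alpha i (tau s) ->
  velocity S (alpha \o tau) s i = d *: velocity S alpha (tau s) i.
Proof. by move=> dtau dc; exact: (@derive1_reparam _ (chart i \o alpha)). Qed.

(** Both terms of the covariant derivative scale by d: the derivative of the
    components by the chain rule, and the Christoffel term because it is linear
    in the velocity. *)
Lemma covd_reparam V W i s d : is_derive s 1 tau d ->
  derivable_coords alpha i (tau s) -> derivable_field V i (tau s) ->
  (\forall u \near s, W u i = V (tau u) i) ->
  covd nabla (alpha \o tau) W s i = d *: covd nabla alpha V (tau s) i.
Proof.
move=> dtau dc dV WV; rewrite /covd (velocity_reparam dtau dc) chrZl.
rewrite (nbhs_singleton WV) scalerDr; congr (_ + _).
rewrite -(@derive1_reparam _ (fun u => V u i))// !derive1E.
exact: near_eq_derive.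
Qed.

End Reparametrization.

Section CubeRootCalculus.
Context {R : realType}.
Variables (I : set R) (w : R -> R).
Hypotheses (I_open : open I) (w_smooth : smooth1 I w).
Hypothesis w_neq0 : forall t, I t -> w t != 0.

Let m t := (cbrt (w t))^-1.

Lemma smooth_cbrt : smooth1 I (fun t => cbrt (w t)).
Proof. exact: smooth1_signed_powR. Qed.

Lemma smooth_inv_cbrt : smooth1 I m.
Proof.
rewrite (_ : m = fun t => Num.sg (w t) * `|w t| `^ (- (3%:R^-1))).
  exact: smooth1_signed_powR.
by apply/funext => t; rewrite /m /cbrt invfM powRN invr_sg.
Qed.

Lemma inv_cbrt_cube t : I t -> m t * m t * m t * w t = 1.
Proof.
move=> It; rewrite -[w t]cbrt_cube /m; have := cbrt_neq0 (w_neq0 It).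
by move=> c0; field.
Qed.

Lemma near_open t : I t -> \forall s \near t, I s.
Proof. by move=> It; exact: open_nbhs_nbhs. Qed.

(** The derivative of the constant m^3 w, divided by m^2. *)
Lemma derive_inv_cbrt t : I t -> 3 * derive1 m t * w t = - (m t * derive1 w t).
Proof.
move=> It; have dm := smooth1_is_derive smooth_inv_cbrt It.
have dw := smooth1_is_derive w_smooth It.
have [_] := is_derive_mulf (is_derive_mulf (is_derive_mulf dm dm) dm) dw.
rewrite (_ : 'D_1 _ t = 0); last first.
  rewrite -(derive_cst (1 : R) t (1 : R)); apply: near_eq_derive.
  by apply: filterS (near_open It) => s Is; rewrite inv_cbrt_cube.
have m0 : m t != 0 by rewrite invr_eq0 cbrt_neq0// w_neq0.
move: (m t) (w t) (derive1 m t) (derive1 w t) m0 => a b a' b' a0 e.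
apply: (mulfI (mulf_neq0 a0 a0)); move: e; lra.
Qed.

Let mm' t := m t * derive1 m t.

(** Obtained by differentiating 3 (m m') w = - m^2 w' and eliminating m'. *)
Lemma derive_inv_cbrt_sqr t : I t -> derive1 mm' t =
  m t ^+ 2 * (5 * derive1 w t ^+ 2 - 3 * w t * derive1 (derive1 w) t)
    / (9 * w t ^+ 2).
Proof.
move=> It; have sm := smooth_inv_cbrt.
have dm := smooth1_is_derive sm It.
have dw := smooth1_is_derive w_smooth It.
have dw1 := smooth1_is_derive (smooth1_derive1 w_smooth) It.
have smm : smooth1 I mm' by exact: (smooth1M I_open sm (smooth1_derive1 sm)).
have dmm := smooth1_is_derive smm It.
have [_ dl] := is_derive_mulf dmm dw.
have [_ dr] := is_derive_mulf (is_derive_mulf dm dm) dw1.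
have e1 s : I s -> 3 * (mm' s * w s) = - (m s * m s * derive1 w s).
  move=> Is; transitivity (m s * (3 * derive1 m s * w s)); first by rewrite /mm'; ring.
  by rewrite derive_inv_cbrt//; ring.
have e2 : 3 * (derive1 mm' t * w t + mm' t * derive1 w t) =
    - ((derive1 m t * m t + m t * derive1 m t) * derive1 w t
       + m t * m t * derive1 (derive1 w) t).
  rewrite -dl -dr -deriveN; last first.
    by apply: derivableM; [apply: derivableM; [have [] := dm|have [] := dm]|have [] := dw1].
  have [dmw _] := is_derive_mulf dmm dw.
  rewrite -[3 * _]/(3 *: _) -deriveZ//; apply: near_eq_derive.
  by apply: filterS (near_open It) => s Is; exact: e1.
have e3 := derive_inv_cbrt It.
move: (w_neq0 It) e2 e3; rewrite /mm' -/mm'.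
move: (m t) (derive1 m t) (w t) (derive1 w t) (derive1 (derive1 w) t) (derive1 mm' t).
move=> a a' b b' b'' x b0 e2 e3.
have b9 : 9 * b ^+ 2 != 0 by rewrite mulf_neq0// ?expf_neq0// pnatr_eq0.
apply: (mulIf b9); rewrite divfK//.
transitivity (3 * b * (3 * (x * b + a * a' * b')) - 9 * b * a * a' * b'); first by ring.
rewrite e2; transitivity (- 5 * a * b' * (3 * a' * b) - 3 * a ^+ 2 * b * b''); first by ring.
by rewrite e3; ring.
Qed.

Lemma derive1n2_inv_cbrt_sqr t : I t ->
  derive1n 2 (fun s => 1 / cbrt (w s) ^+ 2) t = 2 * derive1 mm' t.
Proof.
move=> It; have sm := smooth_inv_cbrt.
have smm : smooth1 I mm' by exact: (smooth1M I_open sm (smooth1_derive1 sm)).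
have [dmm _] := smooth1_is_derive smm It.
rewrite (_ : (fun s => _) = fun s => m s * m s); last first.
  by apply/funext => s; rewrite /m div1r expr2 invfM.
rewrite /derive1n /= !derive1E -[2 * _]/(2 *: _) -deriveZ//.
apply: near_eq_derive; apply: filterS (near_open It) => s Is.
have dm := smooth1_is_derive sm Is.
have [_ dmmE] := is_derive_mulf dm dm.
rewrite derive1E dmmE; transitivity (2 * mm' s) => //.
by rewrite /mm' [X in X + _]mulrC -mulr2n mulr_natl.
Qed.

End CubeRootCalculus.

Section EquiAffine.
Context {R : realType} {M : topologicalType} {S : oriented_surface R M}.
Variables (g : pseudo_riemannian S) (nabla : connection S).
Variables (I : set R) (alpha : R -> M) (t0 : R).
Hypotheses (nabla_LC : levi_civita g nabla) (I_open : open I).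
Hypotheses (I_interval : is_interval I) (I_t0 : I t0).
Hypothesis alpha_smooth : smooth_curve S I alpha.
Hypothesis alpha_arclength : forall t, I t ->
  `|gprod g (alpha t) (velocity S alpha t) (velocity S alpha t)| = 1.
Hypothesis alpha_nondeg : forall t, I t -> Omega_accel g nabla alpha t <> 0.

Let T := velocity S alpha.
Let A := accel nabla alpha.
Let w := Omega_accel g nabla alpha.
Let m t := (cbrt (w t))^-1.
Let sigma := sigma_affine g nabla alpha t0.
Let tau := 'pinv_(fun=> t0) I sigma.
Let beta := alpha_bar g nabla I alpha t0.
Let D (i : idx S) := chart_times I alpha i.

Let w_smooth : smooth1 I w.
Proof. exact: (smooth_Omega_accel g nabla I_open alpha_smooth). Qed.

Let w_neq0 t : I t -> w t != 0.
Proof. by move=> It; apply/eqP/alpha_nondeg. Qed.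

Let m_smooth : smooth1 I m.
Proof. exact: (smooth_inv_cbrt I_open w_smooth w_neq0). Qed.

Lemma mu_affine_continuous t : I t -> {for t, continuous (mu_affine g nabla alpha)}.
Proof. exact: (smooth1_continuous (smooth_cbrt I_open w_smooth w_neq0)). Qed.

Lemma mu_affine_neq0 t : I t -> mu_affine g nabla alpha t != 0.
Proof. by move=> It; exact: (cbrt_neq0 (w_neq0 It)). Qed.

Lemma tau_sigma t : I t -> tau (sigma t) = t.
Proof.
exact: (oriented_integralK I_open I_interval mu_affine_continuous mu_affine_neq0 I_t0).
Qed.

(** Being derivatives, velocity and covariant derivative of beta at sigma t
    depend on tau near that point, not only at it. *)
Lemma near_tau i t : D i t -> \forall s \near sigma t,
  D i (tau s) /\ is_derive s 1 tau (m (tau s)).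
Proof.
move=> Dt; have It := Dt.1.
have [c k] := near_inverse I_open I_interval mu_affine_continuous
  mu_affine_neq0 I_t0 It.
have nD : \forall s \near sigma t, D i (tau s).
  apply: (nbhs_singleton c); rewrite [X in nbhs X](tau_sigma It).
  apply: open_nbhs_nbhs; split=> //.
  exact: (open_chart_times I_open alpha_smooth).
apply: filterS2 nD k => s Ds ks; split=> //.
rewrite -[X in is_derive X](ks : sigma (tau s) = s).
exact: (is_derive_inverse_integral I_open I_interval mu_affine_continuous
  mu_affine_neq0 I_t0 Ds.1).
Qed.

(* The velocity and acceleration of the reparametrized curve beta, as fields
   along alpha: they are m T and m nabla (m T). *)
Let V1 t : tvec S := m t *: T t.
Let V2 t : tvec S := (m t * derive1 m t) *: T t + (m t * m t) *: A t.

Let fieldT i t : D i t -> derivable_field T i t.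
Proof.
exact: (smooth_field_derivable (smooth_velocity I_open alpha_smooth i)).
Qed.

Let fieldA i t : D i t -> derivable_field A i t.
Proof.
exact: (smooth_field_derivable (smooth_accel nabla I_open alpha_smooth i)).
Qed.

Let derivable_fieldZ (f : R -> R) (V : R -> tvec S) (i : idx S) t : derivable f t 1 ->
  derivable_field V i t -> derivable_field (fun s => f s *: V s) i t.
Proof.
move=> df dV k; rewrite (_ : (fun s => _) = fun s => f s * V s i 0 k).
  exact: (derivableM df (dV k)).
by apply/funext => s; rewrite mxE.
Qed.

Let derivable_m t : I t -> derivable m t 1.
Proof. by move=> It; have [] := smooth1_is_derive m_smooth It. Qed.

Let derivable_mm' t : I t -> derivable (fun s => m s * derive1 m s) t 1.
Proof.
move=> It.
by have [] := smooth1_is_derive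
  (smooth1M I_open m_smooth (smooth1_derive1 m_smooth)) It.
Qed.

Let derivable_m2 t : I t -> is_derive t 1 (fun s => m s * m s)
  (2 * (m t * derive1 m t)).
Proof.
move=> It; have dm := smooth1_is_derive m_smooth It.
by apply: (is_derive_eq (is_derive_mulf dm dm)); ring.
Qed.

Lemma velocity_bar i t : D i t ->
  \forall s \near sigma t, velocity S beta s i = V1 (tau s) i.
Proof.
move=> Dt; apply: filterS (near_tau Dt) => s [Ds dtau].
exact: (velocity_reparam dtau (coords_derivable I_open alpha_smooth Ds)).
Qed.

Lemma accel_bar_at i t : D i t -> accel nabla beta (sigma t) i = V2 t i.
Proof.
move=> Dt; have [Ds dtau] := nbhs_singleton (near_tau Dt).
have It := Dt.1; rewrite (tau_sigma It) in Ds.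
have tS := tau_sigma It.
have E : accel nabla beta (sigma t) i = m t *: covd nabla alpha V1 t i.
  have dc : derivable_coords alpha i (tau (sigma t)).
    by rewrite tS; exact: (coords_derivable I_open alpha_smooth Ds).
  have dV : derivable_field V1 i (tau (sigma t)).
    by rewrite tS; exact: (derivable_fieldZ (derivable_m It) (fieldT Dt)).
  have := covd_reparam nabla dtau dc dV (velocity_bar Dt).
  by rewrite tS.
rewrite E (covd_scale nabla alpha (derivable_m It) (fieldT Dt)).
by rewrite scalerDr !scalerA.
Qed.

Lemma accel_bar i t : D i t ->
  \forall s \near sigma t, accel nabla beta s i = V2 (tau s) i.
Proof.
move=> Dt; have [_ k] := near_inverse I_open I_interval mu_affine_continuous
  mu_affine_neq0 I_t0 Dt.1.
apply: filterS2 (near_tau Dt) k => s [Ds _] ks.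
by rewrite -[in LHS](ks : sigma (tau s) = s) accel_bar_at.
Qed.

(** With B = nabla A given by [covd_accel], the left side is m times
    ((m m')' - omega w^2 m^2) T + (3 m m' + m^2 w' / w) A,
    and the coefficient of A vanishes because m^3 w = 1. *)
Lemma covd_accel_bar i t : D i t ->
  covd nabla beta (accel nabla beta) (sigma t) i =
  - (omega g * w t ^+ 2 * m t ^+ 2 - derive1 (fun s => m s * derive1 m s) t)
    *: velocity S beta (sigma t) i.
Proof.
move=> Dt; have [Ds dtau] := nbhs_singleton (near_tau Dt).
have It := Dt.1; rewrite (tau_sigma It) in Ds.
have tS := tau_sigma It; have [dm2 m2E] := derivable_m2 It.
have m2D : derive1 (fun s => m s * m s) t = 2 * (m t * derive1 m t).
  by rewrite derive1E.
have AE : covd nabla alpha A t i =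
    - (omega g * w t ^+ 2) *: T t i + (derive1 w t / w t) *: A t i.
  exact: (covd_accel nabla_LC I_open alpha_smooth alpha_arclength alpha_nondeg Dt).
have dT := fieldT Dt; have dA := fieldA Dt.
have f1 := derivable_fieldZ (derivable_mm' It) dT.
have f2 := derivable_fieldZ dm2 dA.
have E : covd nabla beta (accel nabla beta) (sigma t) i =
    m t *: covd nabla alpha V2 t i.
  have dc : derivable_coords alpha i (tau (sigma t)).
    by rewrite tS; exact: (coords_derivable I_open alpha_smooth Ds).
  have dV : derivable_field V2 i (tau (sigma t)).
    rewrite tS => k; rewrite (_ : (fun s => _) = fun s =>
      ((m s * derive1 m s) *: T s) i 0 k + ((m s * m s) *: A s) i 0 k).
      exact: (derivableD (f1 k) (f2 k)).
    by apply/funext => s; rewrite mxE.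
  have := covd_reparam nabla dtau dc dV (accel_bar Dt).
  by rewrite tS.
rewrite E (covdD nabla alpha f1 f2).
rewrite (covd_scale nabla alpha (derivable_mm' It) dT).
rewrite (covd_scale nabla alpha dm2 dA) m2D AE.
rewrite (nbhs_singleton (velocity_bar Dt)) tS.
rewrite -[covd nabla alpha T t i]/(A t i).
rewrite -[V1 t i]/(m t *: T t i).
have e : 3 * derive1 m t * w t = - (m t * derive1 w t).
  exact: (derive_inv_cbrt I_open w_smooth w_neq0 It).
have w0 := w_neq0 It.
move: (T t i) (A t i) => u v.
move: (derive1 (fun s => m s * derive1 m s) t) => x.
move: (w t) (derive1 w t) (m t) (derive1 m t) w0 e => b b' a a' b0 e.
have a'E : a' = - (a * b') / (3 * b).
  by rewrite -e; field.
by apply/rowP => k; rewrite !mxE a'E; field.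
Qed.

Lemma equiaffine_curvatureE t : I t ->
  equiaffine_curvature g nabla I alpha t0 t =
  omega g * w t ^+ 2 * m t ^+ 2 - derive1 (fun s => m s * derive1 m s) t.
Proof.
move=> It; rewrite /equiaffine_curvature /kappa_bar.
have bt : beta (sigma t) = alpha t by rewrite -[in RHS](tau_sigma It).
apply: get_unique => [i|k].
  rewrite -/beta -/sigma bt => it.
  exact: (covd_accel_bar (conj It it)).
rewrite -/beta -/sigma bt => /(_ _ (dom_chart_at (alpha t))).
pose i := chart_at S (alpha t).
have it : dom i (alpha t) := dom_chart_at (alpha t).
have Dt : D i t := conj It it.
rewrite (covd_accel_bar Dt) -[(- k *: _) _]/(- k *: velocity S beta (sigma t) i).
rewrite (nbhs_singleton (velocity_bar Dt)) (tau_sigma It).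
rewrite -[V1 t i]/(m t *: T t i) => /eqP.
rewrite -subr_eq0 -scalerBl !scaler_eq0 => /or3P[|m0|/eqP T0].
- by rewrite opprK addrC subr_eq0 => /eqP.
- by move: m0; rewrite invr_eq0 (negbTE (cbrt_neq0 (w_neq0 It))).
- have := Omega_accel_chart g nabla I_open alpha_smooth Dt.
  rewrite -/T T0 bil_vol !mxE !mul0r subrr mulr0 => h.
  by have := alpha_nondeg It; rewrite h.
Qed.

End EquiAffine.


Theorem theorem5 (R : realType) (M : topologicalType)
    (S : oriented_surface R M) (g : pseudo_riemannian S) (nabla : connection S)
    (I : set R) (alpha : R -> M) (t0 : R)
    (M_connected : connected [set: M])
    (nabla_LC : levi_civita g nabla)
    (I_open : open I) (I_interval : is_interval I) (I_t0 : I t0)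
    (alpha_smooth : smooth_curve S I alpha)
    (alpha_arclength : forall t, I t ->
       `|gprod g (alpha t) (velocity S alpha t) (velocity S alpha t)| = 1)
    (alpha_nondeg : forall t, I t ->
       Omega g (alpha t) (velocity S alpha t)
         (covd nabla alpha (velocity S alpha) t) <> 0) :
  let kr := frenet_curvature g nabla alpha in
  let ka := equiaffine_curvature g nabla I alpha t0 in
  forall t, I t ->
    ka t = 1 / (9 * cbrt (kr t) ^+ 8) *
             (3 * kr t * derive1n 2 kr t - 5 * (derive1 kr t) ^+ 2
              + 9 * omega g * (kr t) ^+ 4)
    /\
    1 / (9 * cbrt (kr t) ^+ 8) *
      (3 * kr t * derive1n 2 kr t - 5 * (derive1 kr t) ^+ 2 + 9 * omega g * (kr t) ^+ 4)
    = - (1 / 2) * derive1n 2 (fun s => 1 / cbrt (kr s) ^+ 2) t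
      + omega g * cbrt (kr t) ^+ 4.
Proof.
move=> kr ka t It.
pose w := Omega_accel g nabla alpha.
have w_smooth : smooth1 I w := smooth_Omega_accel g nabla I_open alpha_smooth.
have w_neq0 s : I s -> w s != 0 by move=> Is; apply/eqP/alpha_nondeg.
have nI s : I s -> \forall u \near s, I u by move=> Is; exact: open_nbhs_nbhs.
have krE s : I s -> kr s = w s.
  by move=> Is; rewrite /kr (frenet_curvatureE nabla_LC I_open alpha_smooth alpha_arclength alpha_nondeg Is).
have nkr s : I s -> \forall u \near s, kr u = w u.
  by move=> Is; apply: filterS (nI s Is) => u; exact: krE.
have kr1 s : I s -> derive1 kr s = derive1 w s.
  by move=> Is; rewrite !derive1E; apply: near_eq_derive; exact: nkr.
have kr2 : derive1n 2 kr t = derive1 (derive1 w) t.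
  rewrite /derive1n /= !(derive1E (derive1 _)); apply: near_eq_derive.
  by apply: filterS (nI t It) => s; exact: kr1.
have cb2 : derive1n 2 (fun s => 1 / cbrt (kr s) ^+ 2) t =
    derive1n 2 (fun s => 1 / cbrt (w s) ^+ 2) t.
  rewrite /derive1n /= !(derive1E (derive1 _)); apply: near_eq_derive.
  apply: filterS (nI t It) => s Is; rewrite !derive1E; apply: near_eq_derive.
  by apply: filterS (nkr s Is) => u ->.
have := equiaffine_curvatureE nabla_LC I_open I_interval I_t0 alpha_smooth
  alpha_arclength alpha_nondeg It.
rewrite -/ka -/w => ->.
rewrite cb2 (derive1n2_inv_cbrt_sqr I_open w_smooth w_neq0 It).
rewrite (derive_inv_cbrt_sqr I_open w_smooth w_neq0 It) kr2 (kr1 _ It) (krE _ It).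
have := cbrt_neq0 (w_neq0 t It); have := cbrt_cube (w t).
move: (cbrt (w t)) => c.
move: (w t) (derive1 w t) (derive1 (derive1 w) t) (omega g).
move=> b b' b'' om <- c0.
by split; field.
Qed.
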